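(* Let $m>0$ and let $\phi_m^E\in\mathcal{B}_m$ be an energy ground state with mass $m$. Then $\phi_m^E$ is also an action ground state associated with $\omega=-\mu(\phi_m^E)$, i.e. $\phi_m^E\in\mathcal{A}_{\omega}$ with $\omega=-\mu(\phi_m^E)$, where $$\mu(\phi)=\frac{1}{\|\phi\|_{L^2}^2}\left[\frac12\|\nabla\phi\|_{L^2}^2+\int_{\mathbb{R}^d}V|\phi|^2\,d\mathbf{x}+\|\phi\|_{L^{p+1}}^{p+1}\right].$$
   Context: Let $d\ge 1$, let $1<p<\infty$ if $d=1,2$ and $1<p<\frac{d+2}{d-2}$ if $d\ge 3$. Let $V:\mathbb{R}^d\to\mathbb{R}$ satisfy $V\ge 0$ and $\lim_{|\mathbf{x}|\to\infty}V(\mathbf{x})=\infty$. Let $X$ be the space of complex-valued $\phi\in H^1(\mathbb{R}^d)$ with $\int_{\mathbb{R}^d}V|\phi|^2\,d\mathbf{x}<\infty$, with norm $\|\phi\|_X^2=\int_{\mathbb{R}^d}\big(|\nabla\phi|^2+(1+V)|\phi|^2\big)d\mathbf{x}$. For $\phi\in X$ and $\omega\in\mathbb{R}$ define the energy $E(\phi)=\frac12\|\nabla\phi\|_{L^2}^2+\int_{\mathbb{R}^d}V|\phi|^2\,d\mathbf{x}+\frac{2}{p+1}\|\phi\|_{L^{p+1}}^{p+1}$ and the action $S_\omega(\phi)=E(\phi)+\omega\|\phi\|_{L^2}^2$. Put $\omega_0=\inf_{0\ne\phi\in X}\frac{\int_{\mathbb{R}^d}(\frac12|\nabla\phi|^2+V|\phi|^2)d\mathbf{x}}{\|\phi\|_{L^2}^2}>0$.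 An action ground state associated with $\omega$ is an element of $\mathcal{A}_\omega:=\arg\min_{\phi\in X}S_\omega(\phi)$; it is known that for $\omega<-\omega_0$ this set is nonempty, that $\min_X S_\omega<0$, and that it coincides with the set of minimizers of $S_\omega$ over all nontrivial solutions of $-\frac12\Delta\phi+V\phi+|\phi|^{p-1}\phi+\omega\phi=0$. For $m>0$, an energy ground state with mass $m$ is an element of $\mathcal{B}_m:=\arg\min\{E(\phi):\phi\in X,\ \|\phi\|_{L^2}^2=m\}$. *)

(* Defs.v *)
From HB Require Import structures.
From mathcomp Require Import all_boot all_order all_algebra.
From mathcomp Require Import all_classical all_reals all_analysis.
From mathcomp Require Import complex.

Set Implicit Arguments.
Unset Strict Implicit.
Unset Printing Implicit Defensive.

Import Order.TTheory GRing.Theory Num.Theory.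
Import numFieldTopology.Exports numFieldNormedType.Exports.

Local Open Scope classical_set_scope.
Local Open Scope ring_scope.

Definition rV_display : measure_display.
Proof. exact: default_measure_display. Qed.

Section rV_measurable.
Context (R : realType) (n : nat).

Let coors (i : 'I_n) (x : 'rV[R]_n) : measurableTypeR R := x ord0 i.

Let rV_set0 : g_sigma_preimage coors set0.
Proof. exact: sigma_algebra0. Qed.

Let rV_setC A : g_sigma_preimage coors A -> g_sigma_preimage coors (~` A).
Proof. exact: sigma_algebraC. Qed.

Let rV_bigcup (F : (set 'rV[R]_n)^nat) :
  (forall i, g_sigma_preimage coors (F i)) ->
  g_sigma_preimage coors (\bigcup_i (F i)).
Proof. exact: sigma_algebra_bigcup. Qed.

(* The sigma-algebra generated by the coordinates, i.e. the Borel sets of R^n. *)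
HB.instance Definition _ := @isMeasurable.Build rV_display
  'rV[R]_n (g_sigma_preimage coors) rV_set0 rV_setC rV_bigcup.

Lemma measurable_rV_coord (i : 'I_n) :
  measurable_fun [set: 'rV[R]_n] (fun x : 'rV[R]_n => x ord0 i).
Proof.
move=> _ Y mY; rewrite setTI; apply: sub_sigma_algebra => /=.
rewrite -bigcup_seq/=; exists i => /=; first by rewrite mem_index_enum.
by exists Y => //; rewrite setTI.
Qed.

Lemma measurable_fun_rVP d (T : measurableType d) (f : T -> 'rV[R]_n) :
  measurable_fun [set: T] f <->
  forall i, measurable_fun [set: T] (fun t => f t ord0 i).
Proof.
split=> [mf i|mf].
  by apply: (measurableT_comp (measurable_rV_coord i)).
apply: (@measurability _ _ _ _ _ f
  (\big[setU/set0]_(i < n) preimage_set_system setT (coors i) measurable)) => //.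
move=> A [B]; rewrite -bigcup_seq => -[i _ [Y mY <-]] <-.
by rewrite !setTI; have := mf i measurableT Y mY; rewrite setTI.
Qed.

End rV_measurable.

Section rV_lebesgue.
Context (R : realType).

Definition rV_cons n (p : measurableTypeR R * 'rV[R]_n) : 'rV[R]_n.+1 :=
  row_mx (p.1%:M : 'rV_1) p.2.

Definition rV_uncons n (x : 'rV[R]_n.+1) : measurableTypeR R * 'rV[R]_n :=
  (x ord0 ord0, \row_i x ord0 (lift ord0 i)).

Lemma rV_cons0 n p : @rV_cons n p ord0 ord0 = p.1.
Proof.
rewrite /rV_cons (_ : ord0 = lshift n ord0 :> 'I_(1 + n)); last exact/val_inj.
by rewrite (@row_mxEl _ 1 1 n) mxE eqxx mulr1n.
Qed.

Lemma rV_consS n p i : @rV_cons n p ord0 (lift ord0 i) = p.2 ord0 i.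
Proof.
rewrite /rV_cons (_ : lift ord0 i = rshift 1 i :> 'I_(1 + n)); last exact/val_inj.
by rewrite (@row_mxEr _ 1 1 n).
Qed.

Lemma rV_unconsK n : cancel (@rV_uncons n) (@rV_cons n).
Proof.
move=> x; apply/rowP => i; have [j ->|->] := unliftP ord0 i.
  by rewrite rV_consS mxE.
by rewrite rV_cons0.
Qed.

Lemma rV_consK n : cancel (@rV_cons n) (@rV_uncons n).
Proof.
case=> a x; rewrite /rV_uncons rV_cons0; congr pair.
by apply/rowP => i; rewrite mxE rV_consS.
Qed.

Lemma measurable_rV_cons n : measurable_fun setT (@rV_cons n).
Proof.
apply/measurable_fun_rVP => i; have [j ->|->] := unliftP ord0 i.
  under eq_fun do rewrite rV_consS.
  exact: (measurableT_comp (measurable_rV_coord j) measurable_snd).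
by under eq_fun do rewrite rV_cons0; exact: measurable_fst.
Qed.

Lemma measurable_rV_uncons n : measurable_fun setT (@rV_uncons n).
Proof.
apply: measurable_fun_pair; first exact: measurable_rV_coord.
apply/measurable_fun_rVP => i; under eq_fun do rewrite /= mxE.
exact: measurable_rV_coord.
Qed.

Section step.
Context n (mu : {sigma_finite_measure set 'rV[R]_n -> \bar R}).

Definition rV_step : set 'rV[R]_n.+1 -> \bar R :=
  pushforward (@lebesgue_measure R \x mu)%E (@rV_cons n).

Let step0 : rV_step set0 = 0%E.
Proof. by rewrite /rV_step /pushforward preimage_set0 measure0. Qed.

Let step_ge0 A : (0 <= rV_step A)%E.
Proof. by rewrite /rV_step /pushforward; exact: measure_ge0. Qed.

Let mcons A : measurable A -> measurable (@rV_cons n @^-1` A).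
Proof. by move=> mA; rewrite -[X in measurable X]setTI; exact: measurable_rV_cons. Qed.

Let step_sigma_additive : semi_sigma_additive rV_step.
Proof.
move=> F mF tF mUF; rewrite /rV_step /pushforward preimage_bigcup.
apply: measure_semi_sigma_additive.
- by move=> i; exact: mcons.
- apply/trivIsetP => /= i j _ _ ij; rewrite -preimage_setI.
  by move/trivIsetP : tF => /(_ _ _ _ _ ij) ->//; rewrite preimage_set0.
- by rewrite -preimage_bigcup; exact: mcons.
Qed.

HB.instance Definition _ := isMeasure.Build _ _ _ rV_step
  step0 step_ge0 step_sigma_additive.

Let step_sigma_finite : sigma_finite setT rV_step.
Proof.
have /sigma_finiteP[F [TF ndF Foo]] := sigma_finiteT (@lebesgue_measure R).
have /sigma_finiteP[G [TG ndG Goo]] := sigma_finiteT mu.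
exists (fun k => @rV_uncons n @^-1` (F k `*` G k)).
  rewrite -preimage_bigcup (_ : \bigcup_k _ = setT) ?preimage_setT//.
  apply/seteqP; split=> // -[t x] _.
  have [i _ Ft] : (\bigcup_i F i) t by rewrite -TF.
  have [j _ Gx] : (\bigcup_i G i) x by rewrite -TG.
  exists (maxn i j) => //; split => /=.
    by move: Ft; exact/subsetPset/ndF/leq_maxl.
  by move: Gx; exact/subsetPset/ndG/leq_maxr.
move=> k; have [mF Foo_k] := Foo k; have [mG Goo_k] := Goo k; split.
  rewrite -[X in measurable X]setTI; apply: measurable_rV_uncons => //.
  exact: measurableX.
rewrite /rV_step /pushforward -comp_preimage (_ : _ \o _ = id); last first.
  by apply/funext => x /=; rewrite rV_consK.
by rewrite preimage_id product_measure1E// lte_mul_pinfty// ge0_fin_numE.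
Qed.

HB.instance Definition _ := Measure_isSigmaFinite.Build _ _ _ rV_step
  step_sigma_finite.

End step.

(* Iterated product of the one-dimensional Lebesgue measure; rV_lebesgue_box
   gives the expected volume of boxes. *)
Fixpoint rV_lebesgue n : {sigma_finite_measure set 'rV[R]_n -> \bar R} :=
  match n with
  | 0 => \d_(0 : 'rV[R]_0)
  | n.+1 => rV_step (rV_lebesgue n)
  end.

Lemma measurable_rV_box n (a b : 'rV[R]_n) :
  measurable [set x : 'rV[R]_n | forall i, a ord0 i <= x ord0 i <= b ord0 i].
Proof.
rewrite (_ : [set _ | _] = \big[setI/setT]_(i < n)
    ((fun x : 'rV[R]_n => x ord0 i) @^-1` `[a ord0 i, b ord0 i])).
  apply: bigsetI_measurable => i _; rewrite -[X in measurable X]setTI.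
  exact: measurable_rV_coord.
rewrite -bigcap_seq; apply/seteqP; split=> x /= xab i.
  by move=> _; rewrite /= in_itv/= xab.
by have := xab i (mem_index_enum i); rewrite /= in_itv.
Qed.

Lemma rV_lebesgue_box n (a b : 'rV[R]_n) : (forall i, a ord0 i <= b ord0 i) ->
  rV_lebesgue n [set x : 'rV[R]_n | forall i, a ord0 i <= x ord0 i <= b ord0 i]
    = (\prod_(i < n) (b ord0 i - a ord0 i))%:E.
Proof.
elim: n => [|n IH] in a b * => ab.
  by rewrite big_ord0/= diracE mem_set//= => -[].
pose a' := (rV_uncons a).2; pose b' := (rV_uncons b).2.
have E : @rV_cons n @^-1` [set x : 'rV[R]_n.+1 |
      forall i, a ord0 i <= x ord0 i <= b ord0 i] =
    (`[a ord0 ord0, b ord0 ord0] : set (measurableTypeR R)) `*`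
    [set x : 'rV[R]_n | forall i, a' ord0 i <= x ord0 i <= b' ord0 i].
  apply/seteqP; split=> -[t x] /=.
    move=> H; split; first by have := H ord0; rewrite rV_cons0 in_itv.
    by move=> i; have := H (lift ord0 i); rewrite rV_consS !mxE.
  rewrite in_itv/= => -[H0 H] i; have [j ->|->] := unliftP ord0 i.
    by have := H j; rewrite rV_consS !mxE.
  by rewrite rV_cons0.
rewrite /= /rV_step /pushforward E product_measure1E//; last first.
  exact: measurable_rV_box.
rewrite [X in (_ * X)%E]IH; last by move=> i; rewrite !mxE.
move: (lebesgue_measure_itv `[a ord0 ord0, b ord0 ord0]) => /= itvE.
rewrite [X in (X * _)%E]itvE lte_fin big_ord_recl.
under eq_bigr do rewrite !mxE.
rewrite lt_neqAle ab andbT; case: eqVneq => [->|_]/=.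
  by rewrite subrr mul0r mul0e.
by rewrite -EFinB -EFinM.
Qed.

End rV_lebesgue.

Section sobolev.
Context (R : realType) (d : nat).
Local Notation mu := (@rV_lebesgue R d).
Implicit Types (u v phi : 'rV[R]_d -> R[i]) (eta f : 'rV[R]_d -> R).

Definition lebesgue_measurable f :=
  exists2 W : 'rV[R]_d -> R, measurable_fun [set: 'rV[R]_d] W &
    {ae mu, forall x, f x = W x}.

Definition partial (j : 'I_d) f : 'rV[R]_d -> R :=
  fun x => 'D_(delta_mx ord0 j) f x.

Definition smooth f := forall s : seq 'I_d,
  let g := foldr partial f s in
  continuous g /\ forall j x, derivable g x (delta_mx ord0 j).

Definition test_function eta :=
  smooth eta /\ compact (closure [set x | eta x != 0]).

Definition modulus (z : R[i]) : R := ComplexField.Normc.normc z.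

(* Elements of L^2 are represented by Borel measurable functions. *)
Definition L2 u :=
  [/\ measurable_fun [set: 'rV[R]_d] (fun x => complex.Re (u x)),
      measurable_fun [set: 'rV[R]_d] (fun x => complex.Im (u x)) &
      (\int[mu]_x (modulus (u x) ^+ 2)%:E < +oo)%E].

(* Real test functions suffice: the identity is linear in eta. *)
Definition weak_partial (j : 'I_d) u v := forall eta, test_function eta ->
  (\int[mu]_x (complex.Re (u x) * partial j eta x)) =
    - (\int[mu]_x (complex.Re (v x) * eta x)) /\
  (\int[mu]_x (complex.Im (u x) * partial j eta x)) =
    - (\int[mu]_x (complex.Im (v x) * eta x)).

Definition is_weak_gradient u (g : 'I_d -> 'rV[R]_d -> R[i]) :=
  forall j, L2 (g j) /\ weak_partial j u (g j).

Definition H1 u := L2 u /\ exists g, is_weak_gradient u g.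

(* Only meaningful on H1, where it is unique up to a null set. *)
Definition weak_gradient u : 'I_d -> 'rV[R]_d -> R[i] :=
  xget (fun _ _ => 0) [set g | is_weak_gradient u g].

Definition mass phi : \bar R := (\int[mu]_x (modulus (phi x) ^+ 2)%:E)%E.

Definition grad_sqnorm phi : \bar R :=
  (\int[mu]_x (\sum_(j < d) modulus (weak_gradient phi j x) ^+ 2)%:E)%E.

Definition potential_term (V : 'rV[R]_d -> R) phi : \bar R :=
  (\int[mu]_x (V x * modulus (phi x) ^+ 2)%:E)%E.

(* The L^q norm to the power q. *)
Definition Lq_term (q : R) phi : \bar R :=
  (\int[mu]_x (modulus (phi x) `^ q)%:E)%E.

Definition energy_space (V : 'rV[R]_d -> R) : set ('rV[R]_d -> R[i]) :=
  [set phi | H1 phi /\ (potential_term V phi < +oo)%E].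

(* Extended-real valued; finite on energy_space V for the subcritical p, as H1 embeds into
   L^(p+1). *)
Definition energy V (p : R) phi : \bar R :=
  (2^-1%:E * grad_sqnorm phi + potential_term V phi +
    (2 / (p + 1))%:E * Lq_term (p + 1) phi)%E.

Definition action V (p omega : R) phi : \bar R :=
  (energy V p phi + omega%:E * mass phi)%E.

Definition chemical_potential V (p : R) phi : R :=
  fine (2^-1%:E * grad_sqnorm phi + potential_term V phi +
    Lq_term (p + 1) phi)%E / fine (mass phi).

End sobolev.

Definition argmin (T : Type) (R : realType) (A : set T) (F : T -> \bar R) :
    set T :=
  [set x | A x /\ forall y, A y -> (F x <= F y)%E].

Definition action_ground_states (R : realType) (d : nat) (V : 'rV[R]_d -> R)
    (p omega : R) : set ('rV[R]_d -> R[i]) :=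
  argmin (energy_space V) (action V p omega).

Definition energy_ground_states (R : realType) (d : nat) (V : 'rV[R]_d -> R)
    (p m : R) : set ('rV[R]_d -> R[i]) :=
  argmin (energy_space V `&` [set phi | mass phi = m%:E]) (energy V p).

(* Main.v *)
Require Import Defs.
From HB Require Import structures.
From mathcomp Require Import all_boot all_order all_algebra.
From mathcomp Require Import all_classical all_reals all_analysis.
From mathcomp Require Import measurable_realfun complex.
From mathcomp Require Import ring lra.

Import Order.TTheory GRing.Theory Num.Theory.
Import numFieldTopology.Exports numFieldNormedType.Exports.

Local Open Scope classical_set_scope.
Local Open Scope ring_scope.

(** Write q = (p + 1) / 2, A for the sum of the kinetic and potential terms and
    N for the integral of |phi|^(p+1), so that the energy is E = A + N / q.
    As a functional of the density |phi|^2, the energy is convex.  Indeed,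
    given phi, psi in X and 0 < t < 1, put
      w_t = sqrt ((1 - t) |phi|^2 + t |psi|^2).
    The mass and the potential term of w_t are the interpolations of those of
    phi and psi; N (w_t) is at most the interpolation, as s |-> s^q is convex;
    so is the kinetic term.  If phi is an energy ground state of mass m, then
    l = m / mass (w_t) makes sqrt l * w_t an admissible competitor, and
      A (phi) + N (phi) / q <=
        l ((1 - t) A (phi) + t A (psi)) + l^q / q ((1 - t) N (phi) + t N (psi)).
    Both sides agree at t = 0; comparing first order terms in t gives
      mu(phi) (mass psi - m) <= E (psi) - E (phi),
    which says that the action at - mu(phi) is not smaller at psi than at phi.
    Lemma [first_variation] is this computation.

    The kinetic bound comes from difference quotients.  The Euclidean norm is
    1-Lipschitz, so the increments of w = sqrt (a |phi|^2 + b |psi|^2) satisfy,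
    pointwise,
      |w (x + h) - w x|^2 <=
        a |phi (x + h) - phi x|^2 + b |psi (x + h) - psi x|^2,
    and H^1 is characterised by such increments.  If u has a
    weak derivative g in direction j, then the increment of u by h in this
    direction has L^2 norm at most h |g|  ([weak_derivative_incr]).
    Conversely, if those increments are bounded by h C, then
    eta |-> int w d_j eta is a bounded functional on test functions
    ([incr_weak_derivative]), hence represented by an L^2 function.  The
    representation is found by minimising |eta|^2 - 2 L (eta) over the test
    functions ([riesz_subspace]), which uses the completeness of L^2
    ([sqint_complete]).  That an L^2 function is controlled by its pairings
    with test functions ([dual_bound]) follows from the same representation
    and from the fact that only the null function is orthogonal to all test
    functions ([test_function_total]); the latter is obtained from products of
    exp (- 1 / t), which approximate indicators of boxes.

    The integral N is finite at a ground state, as the computation above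
    presupposes: min (|phi|, 1) is bounded and is a 1-Lipschitz function of
    phi, so a multiple of it is a competitor of finite energy
    ([energy_ground_state_Lq_lty]). *)

Set Implicit Arguments.
Unset Strict Implicit.
Unset Printing Implicit Defensive.

(** * Square integrable functions *)

Lemma discriminant_le (R : realType) (a b c : R) : 0 <= a ->
  (forall s, 0 <= a * s ^+ 2 + 2 * b * s + c) -> b ^+ 2 <= a * c.
Proof.
move=> a0 h; have [a00|an0] := eqVneq a 0; first rewrite a00 in h *.
  have [->|bn0] := eqVneq b 0; first by rewrite mul0r expr0n.
  have := h (- (`|c| + 1) / (2 * b)).
  have -> : 2 * b * (- (`|c| + 1) / (2 * b)) = - (`|c| + 1) by field.
  by have := ler_norm c; rewrite !mul0r; lra.
have ap : 0 < a by rewrite lt_def an0.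
have := h (- b / a).
have -> : a * (- b / a) ^+ 2 + 2 * b * (- b / a) + c = c - b ^+ 2 / a by field.
by rewrite subr_ge0 ler_pdivrMr // mulrC.
Qed.

Section square_integrable.
Context d (T : measurableType d) (R : realType).
Variable mu : {measure set T -> \bar R}.
Implicit Types u v w : T -> R.

Definition sqint u := measurable_fun setT u /\
  (\int[mu]_x (u x ^+ 2)%:E < +oo)%E.

Definition ip u v : R := \int[mu]_x (u x * v x).

Lemma sqint_integrable_sqr u : sqint u ->
  mu.-integrable setT (EFin \o (fun x => u x ^+ 2)).
Proof.
move=> [mu1 fu]; apply/integrableP; split.
  by apply/measurable_EFinP; exact: measurable_funX.
by under eq_integral do rewrite /= ger0_norm ?sqr_ge0//.
Qed.

Lemma sqint_integrable_mul u v : sqint u -> sqint v ->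
  mu.-integrable setT (EFin \o (fun x => u x * v x)).
Proof.
move=> su sv; have iu := sqint_integrable_sqr su.
have iv := sqint_integrable_sqr sv.
apply: (le_integrable _ _ _ (integrableD _ iu iv)) => //.
  by apply/measurable_EFinP/measurable_funM; [case: su|case: sv].
move=> x _ /=; rewrite lee_fin (ger0_norm (addr_ge0 (sqr_ge0 _) (sqr_ge0 _))).
rewrite ler_norml; apply/andP; split.
  by have := sqr_ge0 (u x + v x); have := sqr_ge0 (u x);
     have := sqr_ge0 (v x); rewrite sqrrD; lra.
by have := sqr_ge0 (u x - v x); have := sqr_ge0 (u x);
   have := sqr_ge0 (v x); rewrite sqrrB; lra.
Qed.

Lemma sqint0 : sqint (fun=> 0).
Proof.
by split => //; rewrite (eq_integral (cst 0%E)) ?integral0 // => x _ /=; rewrite expr0n.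
Qed.

Lemma sqintDZ a u v : sqint u -> sqint v -> sqint (fun x => a * u x + v x).
Proof.
move=> su sv; have iu := sqint_integrable_sqr su.
have iv := sqint_integrable_sqr sv; have iuv := sqint_integrable_mul su sv.
split.
  apply: measurable_funD; last by case: sv.
  by apply: measurable_funM => //; case: su.
have /integrableP[_] := integrableD measurableT
  (integrableD measurableT (integrableZl measurableT (a ^+ 2) iu) iv)
  (integrableZl measurableT (2 * a) iuv).
apply: le_lt_trans; apply: ge0_le_integral => //.
- by move=> x _; rewrite lee_fin sqr_ge0.
- apply/measurable_EFinP/measurable_funX/measurable_funD; last by case: sv.
  by apply: measurable_funM => //; case: su.
- apply/measurable_EFinP; apply: measurableT_comp => //.
  have mu1 : measurable_fun setT u by case: su.
  have mv : measurable_fun setT v by case: sv.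
  apply: measurable_funD.
    by apply: measurable_funD; [apply: measurable_funM => //|]; exact: measurable_funX.
  by apply: measurable_funM => //; exact: measurable_funM.
- move=> x _ /=; rewrite lee_fin; apply: le_trans (ler_norm _).
  by rewrite le_eqVlt; apply/orP; left; apply/eqP; ring.
Qed.

Lemma sqintD u v : sqint u -> sqint v -> sqint (fun x => u x + v x).
Proof. by move=> su sv; under eq_fun do rewrite -[u _]mul1r; exact: sqintDZ. Qed.

Lemma sqintB u v : sqint u -> sqint v -> sqint (fun x => u x - v x).
Proof.
move=> su sv; have := sqintDZ (-1) sv su.
by under eq_fun do rewrite mulN1r addrC.
Qed.

Lemma sqintZ a u : sqint u -> sqint (fun x => a * u x).
Proof.
move=> su; have := sqintDZ a su sqint0.
by under eq_fun do rewrite addr0.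
Qed.

Lemma ipC u v : ip u v = ip v u.
Proof. by rewrite /ip; under eq_Rintegral do rewrite mulrC. Qed.

Lemma ipDZl a u v w : sqint u -> sqint v -> sqint w ->
  ip (fun x => a * u x + v x) w = a * ip u w + ip v w.
Proof.
move=> su sv sw; have iu := sqint_integrable_mul su sw.
have iv := sqint_integrable_mul sv sw.
rewrite /ip -RintegralZl// -RintegralD//; last exact: (integrableZl measurableT a iu).
by apply: eq_Rintegral => x _; ring.
Qed.

Lemma ipBl u v w : sqint u -> sqint v -> sqint w ->
  ip (fun x => u x - v x) w = ip u w - ip v w.
Proof.
move=> su sv sw; rewrite addrC -mulN1r -ipDZl//.
by congr ip; apply/funext => x; rewrite mulN1r addrC.
Qed.

Lemma ipZl a u w : sqint u -> sqint w ->
  ip (fun x => a * u x) w = a * ip u w.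
Proof.
move=> su sw; have iu := sqint_integrable_mul su sw.
by rewrite /ip -RintegralZl//; apply: eq_Rintegral => x _; ring.
Qed.

Lemma ip_ge0 u : 0 <= ip u u.
Proof. by apply: Rintegral_ge0 => x _; rewrite -expr2 sqr_ge0. Qed.

Lemma ipEFin u : sqint u -> (\int[mu]_x (u x ^+ 2)%:E = (ip u u)%:E)%E.
Proof.
move=> su; rewrite /ip /Rintegral fineK //.
apply: integrable_fin_num => //.
exact: (sqint_integrable_mul su su).
Qed.

Lemma ipDZ_expand s u v : sqint u -> sqint v ->
  ip (fun x => s * u x + v x) (fun x => s * u x + v x) =
  ip u u * s ^+ 2 + 2 * ip u v * s + ip v v.
Proof.
move=> su sv; have suv := sqintDZ s su sv.
by rewrite ipDZl// ![ip _ (fun x => _ + _)]ipC !ipDZl// (ipC v u); ring.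
Qed.

Lemma ipB_expand u v : sqint u -> sqint v ->
  ip (fun x => u x - v x) (fun x => u x - v x) = ip u u - 2 * ip u v + ip v v.
Proof.
move=> su sv; rewrite ipBl//; last exact: sqintB.
by rewrite ![ip _ (fun x => _ - _)]ipC !ipBl// (ipC v u); ring.
Qed.

Lemma ip_CauchySchwarz u v : sqint u -> sqint v ->
  ip u v ^+ 2 <= ip u u * ip v v.
Proof.
move=> su sv; apply: discriminant_le; first exact: ip_ge0.
by move=> s; rewrite -ipDZ_expand//; exact: ip_ge0.
Qed.

End square_integrable.

Lemma geometric_cauchy_cvg (R : realType) (u : R^nat) (C : R) :
  (forall n, `|u n.+1 - u n| <= C / 2 ^+ n) -> cvgn u.
Proof.
move=> uC; suff : cvgn (series (telescope u)).
  rewrite telescopeK => cu; have -> : u = [sequence u n - u 0%N]_n \+ cst (u 0%N).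
    by apply/funext => n /=; rewrite subrK.
  by apply: is_cvgD => //; exact: is_cvg_cst.
apply: normed_cvg; apply: (@series_le_cvg _ _ (geometric C 2^-1)).
- by move=> n; rewrite /= normr_ge0.
- move=> n; rewrite /geometric /= mulr_ge0 ?exprn_ge0 ?invr_ge0 ?ler0n//.
  by have := uC 0%N; rewrite expr0 divr1; apply: le_trans.
- by move=> n; rewrite /telescope /geometric /= exprVn.
- by apply: is_cvg_geometric_series; rewrite ger0_norm ?invr_ge0//; lra.
Qed.

Section completeness.
Context d (T : measurableType d) (R : realType).
Variable mu : {measure set T -> \bar R}.
Local Notation sqint := (sqint mu).
Local Notation ip := (ip mu).

(** Completeness of L^2, for sequences that are Cauchy at a geometric rate.
    The rate replaces the extraction of a subsequence: the sum of
    4^n |u_(n+1) - u_n|^2 has a finite integral, hence is finite almost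
    everywhere, and there the increments are dominated by 2^(-n).  The bound
    on the distance to the limit is then Fatou's lemma. *)
Lemma sqint_complete (u : (T -> R)^nat) (K : R) :
  (forall n, sqint (u n)) ->
  (forall n m, (n <= m)%N ->
    ip (fun x => u m x - u n x) (fun x => u m x - u n x) <= K / 16 ^+ n) ->
  exists2 G, sqint G & forall n,
    ip (fun x => G x - u n x) (fun x => G x - u n x) <= K / 16 ^+ n.
Proof.
move=> su uK.
have mu_ n : measurable_fun setT (u n) by case: (su n).
have sd n m : sqint (fun x => u m x - u n x) by exact: sqintB.
pose f n x := ((4 ^+ n * (u n.+1 x - u n x) ^+ 2)%:E : \bar R).
have f0 n x : (0 <= f n x)%E.
  by rewrite lee_fin mulr_ge0 ?sqr_ge0// exprn_ge0.
have mf n : measurable_fun setT (f n).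
  apply/measurable_EFinP; apply: measurable_funM => //.
  by apply: measurable_funX; exact: measurable_funB.
pose S x := (\sum_(n <oo) f n x)%E.
have mS : measurable_fun setT S by exact: ge0_emeasurable_sum.
have S0 x : (0 <= S x)%E by apply: nneseries_ge0 => n _ _; exact: f0.
have intS : (\int[mu]_x S x < +oo)%E.
  rewrite integral_nneseries//.
  have K0 : 0 <= K.
    by have := le_trans (ip_ge0 _ _) (uK 0%N 0%N (leqnn _)); rewrite expr0 divr1.
  apply: (@le_lt_trans _ _ (\sum_(n <oo) (2 * K / (2 ^ (n + 1))%:R)%:E)%E).
    apply: lee_nneseries => [n _ _|n _] //=; first exact: integral_ge0.
    under eq_integral do rewrite /f EFinM.
    rewrite ge0_integralZl_EFin//; last 2 first.
    - by move=> x _; rewrite lee_fin sqr_ge0.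
    - by apply/measurable_EFinP/measurable_funX; exact: measurable_funB.
    rewrite (ipEFin (sd n n.+1)) -EFinM lee_fin.
    apply: le_trans (ler_wpM2l _ (uK n n.+1 _)) _ => //.
    have -> : 4 ^+ n * (K / 16 ^+ n) = K / 4 ^+ n :> R.
      rewrite (_ : 16 = 4 * 4 :> R); last by ring.
      by rewrite exprMn; field; rewrite expf_neq0.
    have -> : 2 * K / (2 ^ (n + 1))%:R = K / 2 ^+ n.
      by rewrite natrX addn1 exprS; field; rewrite expf_neq0.
    rewrite ler_wpM2l// lef_pV2 ?posrE ?exprn_gt0//.
    by rewrite lerXn2r// ?nnegrE; lra.
  have /cvg_lim cg := @cvg_geometric_eseries_half R (2 * K) 0.
  by rewrite (cg _)// ltry.
pose A := [set x | (S x < +oo)%E].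
have mA : measurable A.
  by rewrite -[A]setTI; exact: emeasurable_fun_infty_o.
have cvgA x : A x -> cvgn (u ^~ x).
  move=> Ax; have Sfin : S x \is a fin_num by rewrite ge0_fin_numE.
  have r0 : 0 <= fine (S x) by exact: fine_ge0.
  apply: (@geometric_cauchy_cvg _ _ (fine (S x) + 1)) => n.
  have : (f n x <= S x)%E.
    apply: le_trans (nneseries_lim_ge n.+1 _) => [|k _ _]; last exact: f0.
    by rewrite big_nat_recr//= leeDr// sume_ge0.
  rewrite -(fineK Sfin) lee_fin => fS.
  rewrite ler_pdivlMr ?exprn_gt0// -(@ler_pXn2r _ 2)// ?nnegrE; last 2 first.
  - by rewrite mulr_ge0// exprn_ge0.
  - lra.
  rewrite exprMn -normrX ger0_norm ?sqr_ge0// -exprM mulnC exprM mulrC.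
  by rewrite (_ : 2 ^+ 2 = 4 :> R); [nra|ring].
(* Off A, where the sequence may diverge, both g n and its limit are 0. *)
pose g n x := u n x * \1_A x.
pose G x := limn (g ^~ x).
have gG x : g ^~ x @ \oo --> G x.
  rewrite /G; apply/cvg_ex => /=; have [Ax|nAx] := pselect (A x).
    have /cvg_ex[l cl] := cvgA x Ax; exists l.
    by rewrite /g indicE mem_set//; under eq_fun do rewrite mulr1.
  exists 0; rewrite /g indicE memNset//; under eq_fun do rewrite mulr0.
  exact: cvg_cst.
have mg n : measurable_fun setT (g n).
  by apply: measurable_funM => //; exact: measurable_indic.
have mG : measurable_fun setT G by exact: (measurable_fun_cvg mg).
have aeA : {ae mu, forall x, A x}.
  have iS : mu.-integrable setT S.
    by apply/integrableP; split => //; under eq_integral do rewrite gee0_abs//.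
  apply: filterS (integrable_ae measurableT iS) => x /(_ I).
  by rewrite ge0_fin_numE.
have key n : (\int[mu]_x ((G x - u n x) ^+ 2)%:E <= (K / 16 ^+ n)%:E)%E.
  pose h m x := (((g m x - g n x) ^+ 2)%:E : \bar R).
  have mh m : measurable_fun setT (h m).
    by apply/measurable_EFinP/measurable_funX; exact: measurable_funB.
  have h0 m x : setT x -> (0 <= h m x)%E by rewrite lee_fin sqr_ge0.
  have hl x : limn_einf (h ^~ x) = ((G x - g n x) ^+ 2)%:E.
    apply: (cvg_limn_einf_sup _).1; apply: cvg_EFin; first exact: nearW.
    by apply: (@cvgM _ _ _ _ _ _ (G x - g n x)); apply: cvgB => //; exact: cvg_cst.
  apply: (@le_trans _ _ (\int[mu]_x limn_einf (h ^~ x))%E).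
    under [leRHS]eq_integral do rewrite hl.
    apply: ae_ge0_le_integral => //.
    - by move=> x _; rewrite lee_fin sqr_ge0.
    - by apply/measurable_EFinP/measurable_funX; exact: measurable_funB.
    - by move=> x _; rewrite lee_fin sqr_ge0.
    - by apply/measurable_EFinP/measurable_funX; exact: measurable_funB.
    - by apply: filterS aeA => x Ax _; rewrite /g indicE mem_set// mulr1.
  apply: le_trans (fatou mu measurableT mh h0) _.
  rewrite limn_einf_lim; apply: lime_le; first exact: is_cvg_einfs.
  apply: nearW => k; apply: (@le_trans _ _ (\int[mu]_x h (maxn k n) x)%E).
    by apply: ereal_inf_lbound => /=; exists (maxn k n) => //=; exact: leq_maxl.
  apply: le_trans (_ : _ <= (\int[mu]_x ((u (maxn k n) x - u n x) ^+ 2)%:E))%E _.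
    apply: ge0_le_integral => //.
    - by move=> x _; exact: h0.
    - by apply/measurable_EFinP/measurable_funX; exact: measurable_funB.
    - move=> x _; rewrite lee_fin /g -mulrBl exprMn indicE.
      by case: (_ \in _); rewrite ?expr1n ?mulr1// expr0n mulr0 sqr_ge0.
  by rewrite (ipEFin (sd _ _)) lee_fin uK// leq_maxr.
have sGu n : sqint (fun x => G x - u n x).
  split; first exact: measurable_funB.
  by apply: le_lt_trans (key n) _; rewrite ltry.
exists G.
  have := sqintD (sGu 0%N) (su 0%N).
  by under eq_fun do rewrite subrK.
by move=> n; rewrite -lee_fin -(ipEFin (sGu n)).
Qed.

End completeness.

(** * A Riesz representation on a subspace *)

Lemma le_geometric_eq0 (R : realType) (x K : R) :
  (forall n, x <= K / 16 ^+ n) -> x <= 0.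
Proof.
move=> h; rewrite leNgt; apply/negP => x0.
have K0 : 0 <= K by have := h 0%N; rewrite expr0 divr1; lra.
have := archi_boundP (divr_ge0 K0 (ltW x0)); set n := Num.bound _ => nK.
have := h n; rewrite leNgt => /negP; apply.
rewrite ltr_pdivrMr ?exprn_gt0// mulrC -ltr_pdivrMr//; apply: (lt_le_trans nK).
rewrite -[16]/(16%:R) -natrX ler_nat; apply: ltnW; apply: ltn_expl.
by [].
Qed.

Section riesz.
Context d (T : measurableType d) (R : realType).
Variable mu : {measure set T -> \bar R}.
Local Notation sqint := (sqint mu).
Local Notation ip := (ip mu).

(** The functional J u = |u|^2 - 2 L u is bounded below by - C.  By the
    parallelogram identity a minimising sequence is Cauchy, and its limit G
    represents L on D, because the first variation of J vanishes there.  As a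
    limit of elements of D, G may lie outside D. *)
Lemma riesz_subspace (D : set (T -> R)) (L : (T -> R) -> R) (C : R) :
  0 <= C -> D (fun=> 0) ->
  (forall a u v, D u -> D v -> D (fun x => a * u x + v x)) ->
  D `<=` sqint ->
  (forall a u v, D u -> D v -> L (fun x => a * u x + v x) = a * L u + L v) ->
  (forall u, D u -> L u ^+ 2 <= C * ip u u) ->
  exists2 G, sqint G & ip G G <= C /\ forall u, D u -> ip G u = L u.
Proof.
move=> C0 D0 DD Ds LD LC.
pose J u := ip u u - 2 * L u.
have J_lb u : D u -> - C <= J u.
  move=> Du; have h := LC u Du; have i0 := ip_ge0 mu u.
  rewrite leNgt; apply/negP; rewrite /J => h1.
  have h2 : ip u u + C < 2 * L u by lra.
  have : (ip u u + C) ^+ 2 < (2 * L u) ^+ 2.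
    by rewrite ltrXn2r// ?nnegrE; lra.
  have := sqr_ge0 (ip u u - C); rewrite exprMn sqrrB sqrrD.
  move: (ip u u) (L u) h => i l; nra.
pose E := [set J u | u in D].
have E0 : E !=set0 by exists (J (fun=> 0)), (fun=> 0).
have hE : has_inf E by split=> //; exists (- C) => _ [u Du <-]; exact: J_lb.
pose I := inf E.
have IJ u : D u -> I <= J u.
  by move=> Du; apply: inf_lbound; [case: hE|exists u].
have e0 n : 0 < (16 ^+ n)^-1 :> R by rewrite invr_gt0 exprn_gt0.
have /choice[u_ u_P] n : exists u, D u /\ J u <= I + (16 ^+ n)^-1.
  have [_ [u Du <-] /ltW h] := inf_adherent (e0 n) hE.
  by exists u.
have su n : sqint (u_ n) by apply: Ds; have [] := u_P n.
have cau n m : (n <= m)%N ->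
    ip (fun x => u_ m x - u_ n x) (fun x => u_ m x - u_ n x) <= 4 / 16 ^+ n.
  move=> nm; have [Dn Jn] := u_P n; have [Dm Jm] := u_P m.
  (* The midpoint, written with the only closure properties at hand: 0 and a u + v. *)
  pose h x := 2^-1 * u_ n x + (2^-1 * u_ m x + 0).
  have Dh : D h by apply: (DD) => //; exact: DD.
  have := IJ h Dh.
  have L0 : L (fun=> 0) = 0.
    have := LD 1 _ _ D0 D0.
    by rewrite (_ : (fun _ => _) = fun=> 0) => [hL|]; [lra|apply/funext => x; ring].
  have Lh : L h = 2^-1 * L (u_ n) + 2^-1 * L (u_ m).
    by rewrite LD//; [congr (_ + _); rewrite LD// L0 addr0|exact: DD].
  have ih : ip h h = (ip (u_ n) (u_ n) + 2 * ip (u_ n) (u_ m) + ip (u_ m) (u_ m)) / 4.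
    rewrite /h; under eq_fun do rewrite addr0.
    rewrite ipDZ_expand//; last exact: sqintZ.
    rewrite [ip _ (fun x => _ * _)]ipC ipZl// [ip (u_ m) _]ipC.
    have su2 : sqint (fun x => 2^-1 * u_ m x) by exact: sqintZ.
    by rewrite (ipZl _ _ su2)// [ip _ (fun x => _ * _)]ipC ipZl//; field.
  have id : ip (fun x => u_ m x - u_ n x) (fun x => u_ m x - u_ n x) =
     ip (u_ n) (u_ n) - 2 * ip (u_ n) (u_ m) + ip (u_ m) (u_ m).
    by rewrite ipB_expand// (ipC _ (u_ m)); ring.
  have emn : (16 ^+ m)^-1 <= (16 ^+ n)^-1 :> R.
    by rewrite lef_pV2 ?posrE ?exprn_gt0// ler_eXn2l//; lra.
  by move: Jn Jm; rewrite /J Lh ih id; lra.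
have [G sG Gu] := sqint_complete su cau.
exists G => //.
have sd n : sqint (fun x => G x - u_ n x) by exact: sqintB.
have GL u : D u -> ip G u = L u.
  move=> Du.
  have h n : (ip (u_ n) u - L u) ^+ 2 <= ip u u * (16 ^+ n)^-1.
    (* J (u_n + s u) is at least inf J >= J (u_n) - 16^(-n) for all s. *)
    apply: discriminant_le; first exact: ip_ge0.
    move=> s; have [Dn Jn] := u_P n.
    have := IJ _ (DD s _ _ Du Dn).
    rewrite /J LD// ipDZ_expand//; last exact: Ds.
    rewrite (ipC _ u); move: Jn; rewrite /J; lra.
  have h2 n : (ip G u - ip (u_ n) u) ^+ 2 <= 4 / 16 ^+ n * ip u u.
    rewrite -ipBl//; last exact: Ds.
    apply: le_trans (ip_CauchySchwarz _ _) _ => //; first exact: Ds.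
    by rewrite ler_wpM2r// ip_ge0.
  apply/eqP; rewrite -subr_eq0 -sqrf_eq0 eq_le sqr_ge0 andbT.
  apply: (@le_geometric_eq0 _ _ (10 * ip u u)) => n.
  have := h n; have := h2 n; have := sqr_ge0 (ip G u - ip (u_ n) u - (ip (u_ n) u - L u)).
  rewrite -!mulrA [X in _ <= X -> _]mulrC.
  set a := ip G u; set b := ip (u_ n) u; set c := L u; set e := _^-1; set i := ip u u.
  by nra.
split => //.
rewrite -subr_le0; apply: (@le_geometric_eq0 _ _ 4) => n.
have := Gu n; have [Dn Jn] := u_P n.
have := J_lb _ Dn; rewrite /J.
by rewrite ipB_expand// (GL (u_ n))//; lra.
Qed.

End riesz.

(** * Boxes, and Lebesgue measure on 'rV[R]_n *)

Section boxes.
Context (R : realType) (n : nat).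
Implicit Types a b x : 'rV[R]_n.

Definition box a b := [set x : 'rV[R]_n | forall i, a ord0 i <= x ord0 i <= b ord0 i].

Definition boxes := [set A : set 'rV[R]_n | exists a b, A = box a b].

Definition cube (k : R) : set 'rV[R]_n := box (const_mx (- k)) (const_mx k).

Lemma cubeP k x : cube k x <-> forall i, `|x ord0 i| <= k.
Proof.
by split=> h i; move: (h i); rewrite !mxE ler_norml.
Qed.

Lemma cubeE k x : 0 <= k -> cube k x <-> `|x| <= k.
Proof.
move=> k0; rewrite cubeP; split.
  move=> h; rewrite [leLHS]/Num.norm /= mx_normrE.
  by apply/bigmax_leP; split => // -[i j] _ /=; rewrite (ord1 i).
move=> h i; apply: le_trans h; rewrite [leRHS]/Num.norm /= mx_normrE.
by apply/bigmax_geP; right; exists (ord0, i).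
Qed.

Lemma bigcup_cube : \bigcup_k cube k%:R = [set: 'rV[R]_n].
Proof.
rewrite -subTset => x _; exists (Num.bound `|x|) => //.
by apply/cubeE => //; apply/ltW/archi_boundP.
Qed.

(** Closed boxes are a generating pi-system, which reduces identities between
    measures to boxes. *)
Lemma measurable_boxes : (measurable : set (set 'rV[R]_n)) = <<s boxes >>.
Proof.
apply/seteqP; split; last first.
  apply: smallest_sub; first exact: sigma_algebra_measurable.
  by move=> _ [a [b ->]]; exact: measurable_rV_box.
apply: smallest_sub; first exact: smallest_sigma_algebra.
rewrite -bigcup_seq => A [i _] [Y mY <-].
pose BT := g_sigma_algebraType boxes.
have : measurable_fun [set: BT] (fun x : BT => (x : 'rV[R]_n) ord0 i : measurableTypeR R).
  apply: (measurability (@RGenCInfty.G R)) => [|/= _ [_] [r] -> <-].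
    exact: RGenCInfty.measurableE.
  rewrite (_ : _ `&` _ = \bigcup_k box
    (\row_j if j == i then r else - k%:R) (const_mx k%:R)).
    apply: bigcupT_measurable => k; apply: sub_sigma_algebra.
    by eexists; eexists; reflexivity.
  rewrite setTI; apply/seteqP; split => x /=; rewrite in_itv/= andbT.
    move=> rx; have : [set: 'rV[R]_n] x by []. rewrite -bigcup_cube => -[k _ /cubeP xk].
    exists k => // j; rewrite !mxE; have := xk j; rewrite ler_norml => /andP[h1 ->].
    by rewrite andbT; case: eqP => // ->.
  by case=> k _ /(_ i); rewrite !mxE eqxx => /andP[].
by move=> /(_ measurableT _ mY).
Qed.

Lemma boxesI : setI_closed boxes.
Proof.
move=> _ _ [a [b ->]] [a' [b' ->]].
exists (\row_i Num.max (a ord0 i) (a' ord0 i)), (\row_i Num.min (b ord0 i) (b' ord0 i)).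
apply/seteqP; split=> x /=.
  by move=> [h h'] i; rewrite !mxE ge_max le_min; move: (h i) (h' i) => /andP[-> ->] /andP[-> ->].
move=> h; split => i; have := h i; rewrite !mxE ge_max le_min => /andP[/andP[h1 h2] /andP[h3 h4]].
  by rewrite h1 h3.
by rewrite h2 h4.
Qed.

Lemma rV_measure_unique (m1 m2 : {measure set 'rV[R]_n -> \bar R}) :
  (forall a b, m1 (box a b) = m2 (box a b)) ->
  (forall k : nat, (m1 (cube k%:R) < +oo)%E) ->
  forall A, measurable A -> m1 A = m2 A.
Proof.
move=> m12 m1oo A mA; apply: (measure_unique boxes (fun k => cube k%:R)) => //.
- exact: measurable_boxes.
- exact: boxesI.
- by move=> k; eexists; eexists; reflexivity.
- exact: bigcup_cube.
- by move=> _ [a [b ->]].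
Qed.

Lemma rV_lebesgue_box_lty a b : (rV_lebesgue R n (box a b) < +oo)%E.
Proof.
have [h|h] := pselect (forall i, a ord0 i <= b ord0 i).
  by rewrite rV_lebesgue_box// ltry.
rewrite (_ : box a b = set0) ?measure0//.
apply/seteqP; split => // x xab; apply: h => i.
by have /andP[] := xab i; exact: le_trans.
Qed.

Lemma measurable_rV_translate (v : 'rV[R]_n) :
  measurable_fun setT (fun x : 'rV[R]_n => x + v).
Proof.
apply/measurable_fun_rVP => i; under eq_fun do rewrite mxE.
by apply: measurable_funD => //; exact: measurable_rV_coord.
Qed.

(** The translates of a box have its volume, and boxes determine a measure. *)
Lemma rV_lebesgue_translate (v : 'rV[R]_n) A : measurable A ->
  rV_lebesgue R n ((fun x => x + v) @^-1` A) = rV_lebesgue R n A.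
Proof.
pose nu' : {measure set 'rV[R]_n -> \bar R} :=
  pushforward (rV_lebesgue R n) (fun x : 'rV[R]_n => x + v).
pose nu := nu' (measurable_rV_translate v).
have nuE a b : nu (box a b) = rV_lebesgue R n (box a b).
  have -> : nu (box a b) = rV_lebesgue R n (box (a - v) (b - v)).
    rewrite /nu/nu'/= /pushforward; congr (rV_lebesgue R n _).
    by apply/seteqP; split => x h i; have := h i; rewrite !mxE lerBlDr lerBrDr.
  have [h|h] := pselect (forall i, a ord0 i <= b ord0 i).
    rewrite !rV_lebesgue_box//; last by move=> i; rewrite !mxE lerD2r.
    by congr (_%:E); apply: eq_bigr => i _; rewrite !mxE; ring.
  have [i abi] : exists i, b ord0 i < a ord0 i.
    by apply: contrapT => h'; apply: h => i; rewrite leNgt; apply/negP => hi; apply: h'; exists i.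
  rewrite (_ : box _ _ = set0); last first.
    by apply/seteqP; split => // x /(_ i); rewrite !mxE => /andP[h1 h2]; lra.
  rewrite (_ : box _ _ = set0) ?measure0//.
  by apply/seteqP; split => // x /(_ i) => /andP[h1 h2]; lra.
move=> mA; apply: (@rV_measure_unique nu (rV_lebesgue R n)) => // k.
by rewrite nuE rV_lebesgue_box_lty.
Qed.

(** The sigma-algebra is generated by coordinates and not by open sets: an open
    set has to be written as a countable union of boxes with rational
    corners. *)
Lemma continuous_measurable_rV (f : 'rV[R]_n -> R) : continuous f ->
  measurable_fun setT f.
Proof.
move=> cf; apply: (measurability (@RGenOInfty.G R)) => [|/= _ [_] [r] -> <-].
  exact: RGenOInfty.measurableE.
rewrite setTI; set O := _ @^-1` _.
have oO : open O by apply: open_comp => //; exact: rray_open.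
(* The boxes with rational corners that are contained in O cover it. *)
pose q2r (q : 'rV[rat]_n) : 'rV[R]_n := map_mx ratr q.
rewrite (_ : O = \bigcup_(q : 'rV[rat]_n * 'rV[rat]_n)
   (if `[< box (q2r q.1) (q2r q.2) `<=` O >] then box (q2r q.1) (q2r q.2) else set0)).
  apply: countable_bigcupT_measurable; first exact: countableP.
  by move=> q; case: asboolP => // _; exact: measurable_rV_box.
apply/seteqP; split => x; last by move=> [q _]; case: asboolP => // h; exact: h.
move=> Ox; have : nbhs x O by exact: open_nbhs_nbhs.
rewrite -nbhs_nbhs_norm => -[e /= e0 eO].
have e2 : 0 < e / 2 by rewrite divr_gt0.
have /choice[q qP] i : exists q, ratr q \in `]x ord0 i - e / 2, x ord0 i[.
  by apply: rat_in_itvoo; rewrite ltrBlDr ltrDl.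
have /choice[r' rP] i : exists q, ratr q \in `]x ord0 i, x ord0 i + e / 2[.
  by apply: rat_in_itvoo; rewrite ltrDl.
exists (\row_i q i, \row_i r' i) => //; rewrite asboolT.
  move=> i; rewrite !mxE /=; have := qP i; have := rP i; rewrite !in_itv/=.
  by move=> /andP[/ltW -> _] /andP[_ /ltW ->].
apply: subset_trans eO => y yq /=; apply: (@le_lt_trans _ _ (e / 2)); last lra.
apply/cubeE; first exact: ltW.
apply/cubeP => i; have := yq i; have := qP i; have := rP i.
rewrite !in_itv/= !mxE => /andP[_ h1] /andP[h2 _] /andP[h3 h4].
by rewrite ler_norml; apply/andP; split; lra.
Qed.

End boxes.

(** * A flat smooth function *)

Section flat_exponential.
Context (R : realType).
Implicit Types (P : {poly R}) (t y : R).

(** P (1 / t) exp (- 1 / t) extended by 0 for t <= 0.  Allowing a polynomial P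
    makes the family stable under differentiation, so that the smoothness of
    exp (- 1 / t) is a statement about first derivatives only. *)
Definition flatexp P t : R := if 0 < t then P.[t^-1] * expR (- t^-1) else 0.

Lemma poly_expRN_bounded P :
  exists2 C, 0 <= C & forall y, 0 <= y -> `|P.[y]| * expR (- y) <= C.
Proof.
have mono n y : 0 <= y -> y ^+ n * expR (- y) <= n`!%:R.
  move=> y0; rewrite expRN ler_pdivrMr ?expR_gt0//; case: n => [|n].
    by rewrite expr0 fact0 mul1r -[leLHS]expR0 ler_expR.
  have := expR_ge1Dxn n y0; rewrite -ler_pdivrMl ?ltr0n ?fact_gt0//.
  by rewrite mulrC; apply: le_trans; rewrite lerDr.
exists (\sum_(i < size P) `|P`_i| * i`!%:R).
  by apply: sumr_ge0 => i _; rewrite mulr_ge0.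
move=> y y0; rewrite horner_coef.
apply: le_trans (ler_wpM2r (expR_ge0 _) (ler_norm_sum _ _ _)) _.
rewrite mulr_suml; apply: ler_sum => i _.
by rewrite normrM -mulrA ler_wpM2l// normrX (ger0_norm y0) mono.
Qed.

(** Gives the derivative 0 at the origin, for all P at once. *)
Lemma flatexp_quadratic P : exists2 C, 0 <= C & forall t, `|flatexp P t| <= C * t ^+ 2.
Proof.
have [C C0 hC] := poly_expRN_bounded ('X^2 * P).
exists C => // t; rewrite /flatexp; case: ifPn => t0; last first.
  by rewrite normr0 mulr_ge0// sqr_ge0.
have ti0 : 0 <= t^-1 by rewrite invr_ge0 ltW.
have := hC _ ti0; rewrite hornerM hornerXn normrM (ger0_norm (exprn_ge0 _ ti0)).
rewrite normrM (ger0_norm (expR_ge0 _)) exprVn -mulrA.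
by rewrite ler_pdivrMl ?exprn_gt0// (mulrC C).
Qed.

Lemma is_derive_flatexp P t :
  is_derive t 1 (flatexp P) (flatexp ('X^2 * (P - P^`())) t).
Proof.
have [t0|t0|t0] : [\/ 0 < t, t < 0 | t = 0].
  by have [->|] := eqVneq t 0; [apply: Or33|rewrite neq_lt => /orP[]; [apply: Or32|apply: Or31]].
- rewrite {2}/flatexp t0.
  have E : \near t, P.[t^-1] * expR (- t^-1) = flatexp P t.
    near=> s; rewrite /flatexp ifT//; near: s.
    exact: lt_nbhsr.
  apply: (near_eq_is_derive E).
  have tn0 : t != 0 by rewrite gt_eqF.
  have dinv : is_derive t 1 (fun s : R => s^-1) (- t ^- 2 *: 1).
    exact: is_deriveV.
  have dP : is_derive t 1 (fun s : R => P.[s^-1]) (P^`().[t^-1] * (- t ^- 2)).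
    apply: (@is_derive1_comp _ (horner P) (fun s => s^-1)).
    by rewrite scaler1 in dinv.
  have dE : is_derive t 1 (fun s : R => expR (- s^-1)) (expR (- t^-1) * (t ^- 2)).
    apply: (@is_derive1_comp _ expR (fun s => - s^-1)).
    have := is_deriveN dinv.
    by rewrite scaler1 opprK.
  apply: (is_derive_eq (is_deriveM dP dE)).
  rewrite hornerM hornerXn hornerD hornerN /=.
  by rewrite /GRing.scale /= exprVn; ring.
- rewrite {2}/flatexp ltNge ltW//=.
  have E : \near t, cst 0 t = flatexp P t.
    near=> s; rewrite /flatexp ltNge ltW//=; near: s.
    exact: lt_nbhsl.
  by apply: (near_eq_is_derive E); exact: is_derive_cst.
- subst t; rewrite {2}/flatexp ltxx.
  have [C C0 hC] := flatexp_quadratic P.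
  have f0 : flatexp P 0 = 0 by rewrite /flatexp ltxx.
  have cv : h^-1 *: (flatexp P (h *: 1 + 0) - flatexp P 0) @[h --> 0^'] --> (0 : R).
    apply/cvgrPdist_le => /= e e0.
    near=> h.
    have h0 : h != 0 by near: h; exact: nbhs_dnbhs_neq.
    rewrite sub0r normrN f0 subr0 addr0 /GRing.scale /= mulr1 normrM normfV.
    rewrite ler_pdivrMl ?normr_gt0//.
    apply: le_trans (hC h) _.
    rewrite -(ger0_norm (sqr_ge0 h)) expr2 normrM mulrA [leRHS]mulrC ler_wpM2r//.
    have hd : `|h| <= e / (C + 1).
      near: h; apply: dnbhs0_le; rewrite divr_gt0//; lra.
    have C1 : 0 < C + 1 by lra.
    move: hd; rewrite ler_pdivlMr// => hd.
    by have := normr_ge0 h; nra.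
  split.
    by apply/cvg_ex; exists 0.
  by apply/cvg_lim.
Unshelve. all: by end_near. Qed.

End flat_exponential.

(** * Smooth functions and test functions *)

Section smooth_functions.
Context (R : realType) (n : nat).
Implicit Types (f g eta : 'rV[R]_n -> R) (x : 'rV[R]_n) (j : 'I_n).
Local Notation e_ j := (delta_mx ord0 j : 'rV[R]_n).

(** An inductive form of smoothness, for which stability under products is a
    plain induction on k. *)
Fixpoint Ck (k : nat) f : Prop :=
  continuous f /\ if k is k'.+1 then
    (forall j x, derivable f x (e_ j)) /\ forall j, Ck k' (partial j f)
  else True.

Lemma smooth_partial f j : smooth f -> smooth (partial j f).
Proof. by move=> sf s; have := sf (rcons s j); rewrite foldr_rcons. Qed.

Lemma smoothP f : smooth f <-> forall k, Ck k f.
Proof.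
split=> [+ k|].
  elim: k f => [|k IH] f sf; first by split=> //; have [] := sf [::].
  split; first by have [] := sf [::].
  split; first by have [] := sf [::].
  by move=> j; apply/IH/smooth_partial.
move=> fk s; elim/last_ind: s f fk => [|s j IH] f fk.
  by have [? [? _]] := fk 1%N.
by rewrite foldr_rcons; apply: IH => k; have [_ [_ h]] := fk k.+1; exact: h.
Qed.

Lemma CkS k f : Ck k.+1 f -> Ck k f.
Proof.
elim: k f => [|k IH] f; first by case.
by move=> [cf [df pf]]; split=> //; split=> // j; apply: IH.
Qed.

Lemma Ck_cst k c : Ck k (fun=> c).
Proof.
have cc (a : R) : continuous (fun _ : ('rV[R]_n) => a) by exact: cst_continuous.
elim: k c => [|k IH] c; first by split.
split; first exact: cc.
split=> [j x|j]; first exact: derivable_cst.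
rewrite (_ : partial j _ = fun=> 0) //.
by apply/funext => x; rewrite /partial derive_cst.
Qed.

Lemma CkD k f g : Ck k f -> Ck k g -> Ck k (fun x => f x + g x).
Proof.
elim: k f g => [|k IH] f g [cf] Cf [cg] Cg.
  by split=> // x; exact: (continuousD (cf x) (cg x)).
split; first by move=> x; exact: (continuousD (cf x) (cg x)).
case: Cf Cg => df pf [dg pg]; split => [j x|j]; first exact: derivableD.
rewrite (_ : partial j _ = fun x => partial j f x + partial j g x).
  exact: (IH _ _ (pf j) (pg j)).
by apply/funext => x; rewrite /partial deriveD.
Qed.

Lemma CkM k f g : Ck k f -> Ck k g -> Ck k (fun x => f x * g x).
Proof.
elim: k f g => [|k IH] f g Cf Cg; have [cf Cf'] := Cf; have [cg Cg'] := Cg.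
  by split=> // x; exact: (continuousM (cf x) (cg x)).
split; first by move=> x; exact: (continuousM (cf x) (cg x)).
case: Cf' Cg' => df pf [dg pg]; split => [j x|j]; first exact: derivableM.
rewrite (_ : partial j _ = fun x => f x * partial j g x + g x * partial j f x).
  apply: CkD; apply: IH; [exact: CkS|exact: pg|exact: CkS|exact: pf].
by apply/funext => x; rewrite /partial deriveM.
Qed.

Lemma smooth_cst c : smooth (fun _ : 'rV[R]_n => c).
Proof. by apply/smoothP => k; exact: Ck_cst. Qed.

Lemma smoothD f g : smooth f -> smooth g -> smooth (fun x => f x + g x).
Proof. by move=> /smoothP sf /smoothP sg; apply/smoothP => k; exact: CkD. Qed.

Lemma smoothM f g : smooth f -> smooth g -> smooth (fun x => f x * g x).
Proof. by move=> /smoothP sf /smoothP sg; apply/smoothP => k; exact: CkM. Qed.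

Lemma smooth_prod (I : Type) (s : seq I) (F : I -> 'rV[R]_n -> R) :
  (forall i, smooth (F i)) -> smooth (fun x => \prod_(i <- s) F i x).
Proof.
move=> sF; elim: s => [|i s IH].
  have -> : (fun x => \prod_(i <- [::]) F i x) = fun=> 1.
    by apply/funext => x; rewrite big_nil.
  exact: smooth_cst.
have -> : (fun x => \prod_(k <- i :: s) F k x) = fun x => F i x * \prod_(k <- s) F k x.
  by apply/funext => x; rewrite big_cons.
exact: (smoothM (sF i) IH).
Qed.

Lemma growth_rate_translate f (v x : 'rV[R]_n) j :
  (fun h => h^-1 *: (((fun x => f (x + v)) \o shift x) (h *: e_ j) - f (x + v))) =
  (fun h => h^-1 *: ((f \o shift (x + v)) (h *: e_ j) - f (x + v))).
Proof. by apply/funext => h /=; rewrite addrA. Qed.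

Lemma partial_translate f (v : 'rV[R]_n) j :
  partial j (fun x => f (x + v)) = fun x => partial j f (x + v).
Proof.
by apply/funext => x; rewrite /partial /derive growth_rate_translate.
Qed.

Lemma smooth_translate f (v : 'rV[R]_n) : smooth f -> smooth (fun x => f (x + v)).
Proof.
have ct g : continuous g -> continuous (fun x => g (x + v)).
  move=> cg x; apply: (@continuous_comp _ _ _ (fun x => x + v) g); last exact: cg.
  exact: (continuousD (f := id) (@cvg_id _ (nbhs x)) (@cst_continuous _ _ v x)).
move=> /smoothP sf; apply/smoothP => k; move: sf => /(_ k).
elim: k f => [|k IH] f [cf]; first by split => //; exact: ct.
move=> [df pf]; split; first exact: ct.
split => [j x|j]; last first.
  by rewrite partial_translate; exact: (IH _ (pf j)).
by have := df j (x + v); rewrite /derivable growth_rate_translate.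
Qed.

Lemma smooth_flatexp_coord (P : {poly R}) (i : 'I_n) (c b : R) :
  smooth (fun x : 'rV[R]_n => flatexp P (c * x ord0 i + b)).
Proof.
pose G (P : {poly R}) (s : R) := flatexp P (c * s + b).
have dG (P0 : {poly R}) (s : R) : is_derive s (1 : R) (G P0)
    (flatexp (c%:P * ('X^2 * (P0 - P0^`()))) (c * s + b)).
  have dl : is_derive s (1 : R) (fun s : R => c * s + b) c.
    by apply: is_derive_eq; rewrite addr0 [_ *: _]mulr1.
  have dG := @is_derive1_comp R (flatexp P0) _ s _ _ (is_derive_flatexp _ _) dl.
  apply: (is_derive_eq dG); rewrite /flatexp; case: ifP; rewrite ?mul0r// => _.
  by rewrite [in RHS]hornerM hornerC /=; ring.
have growth (P0 : {poly R}) x j :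
  (fun h => h^-1 *: (((fun x : 'rV[R]_n => G P0 (x ord0 i)) \o shift x) (h *: e_ j) - G P0 (x ord0 i))) =
  (fun h => h^-1 *: ((G P0 \o shift (x ord0 i)) (h *: (i == j)%:R) - G P0 (x ord0 i))).
  by apply/funext => h /=; rewrite !mxE eqxx.
have cG (P0 : {poly R}) : continuous (fun x : 'rV[R]_n => G P0 (x ord0 i)).
  move=> x; apply: (@continuous_comp _ _ _ (fun x : 'rV[R]_n => x ord0 i) (G P0)).
    exact: coord_continuous.
  apply: differentiable_continuous; apply/derivable1_diffP.
  by have [] := dG P0 (x ord0 i).
apply/smoothP => k; elim: k P => [|k IH] P0; first by split=> //; exact: cG.
split; first exact: cG.
split=> [j x|j].
  rewrite /derivable growth; case: eqP => _; last exact: derivable0.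
  by have [] := dG P0 (x ord0 i).
have [ij|ij] := eqVneq i j.
  rewrite (_ : partial j _ = fun x => flatexp (c%:P * ('X^2 * (P0 - P0^`()))) (c * x ord0 i + b)).
    exact: IH.
  apply/funext => x; rewrite /partial /derive growth ij eqxx.
  by have [_ <-] := dG P0 (x ord0 j).
rewrite (_ : partial j _ = fun=> 0); first exact: Ck_cst.
apply/funext => x; rewrite /partial /derive growth (negbTE ij).
exact: derive0.
Qed.

(** Turns partial derivatives into ordinary ones, so that the mean value
    theorem applies. *)
Lemma line_is_derive f x j (t : R) : (forall y, derivable f y (e_ j)) ->
  is_derive t 1 (fun s => f (s *: e_ j + x)) (partial j f (t *: e_ j + x)).
Proof.
move=> df; have := df (t *: e_ j + x).
rewrite /partial /derive /derivable.
have -> : (fun h => h^-1 *: ((f \o shift (t *: e_ j + x)) (h *: e_ j) - f (t *: e_ j + x))) =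
  (fun h => h^-1 *: (((fun s => f (s *: e_ j + x)) \o shift t) (h *: 1) - f (t *: e_ j + x))).
  by apply/funext => h /=; rewrite scalerDl addrA /GRing.scale/= mulr1.
by move=> h; split.
Qed.

Lemma closed_norm_le (M : R) : closed [set x : 'rV[R]_n | `|x| <= M].
Proof.
apply: (@closed_comp _ _ (fun x : 'rV[R]_n => `|x|) [set y | y <= M]).
  by move=> x _; exact: norm_continuous.
exact: closed_le.
Qed.

Lemma compact_norm_le (M : R) : compact [set x : 'rV[R]_n | `|x| <= M].
Proof.
apply: bounded_closed_compact; last exact: closed_norm_le.
exists M; split; first exact: num_real.
by move=> M' MM' x xM; exact: le_trans xM (ltW MM').
Qed.

Lemma test_functionP eta :
  test_function eta <-> smooth eta /\ exists M : R, forall x, eta x != 0 -> `|x| <= M.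
Proof.
split=> -[se ce]; split=> //.
  have /compact_bounded [M [_ hM]] := ce.
  exists (M + 1) => x ex; apply: hM; first by rewrite ltrDl.
  exact: subset_closure.
have [M hM] := ce; apply: (subclosed_compact _ (@compact_norm_le M)).
  exact: closed_closure.
rewrite [X in _ `<=` X](closure_id _).1; last exact: closed_norm_le.
exact: closure_subset.
Qed.

Lemma bounded_of_bounded_support f (M : R) : continuous f ->
  (forall x, f x != 0 -> `|x| <= M) -> exists2 C : R, 0 <= C & forall x, `|f x| <= C.
Proof.
move=> cf fM.
have /compact_bounded [C [_ hC]] : compact (f @` [set x | `|x| <= M]).
  apply: continuous_compact; last exact: compact_norm_le.
  exact: continuous_subspaceT.
exists (`|C| + 1) => [|x]; first by rewrite addr_ge0.
have [->|fx0] := eqVneq (f x) 0; first by rewrite normr0 addr_ge0.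
apply: hC; first by rewrite (le_lt_trans (ler_norm _))// ltrDl.
by exists x => //=; exact: fM.
Qed.

Lemma partial_support f (M : R) j : (forall x, f x != 0 -> `|x| <= M) ->
  forall x, partial j f x != 0 -> `|x| <= M.
Proof.
move=> fM x; apply: contraR; rewrite -ltNge => Mx; apply/eqP.
rewrite /partial (@near_eq_derive _ _ _ f (cst 0)) ?derive_cst//.
have : open (~` [set x : 'rV[R]_n | `|x| <= M]).
  by apply: closed_openC; exact: closed_norm_le.
move=> /(_ x); rewrite /= => /(_ _)/filterS; apply.
  by move=> y /= /negP yM; apply/eqP; apply: contraR yM; exact: fM.
by apply/negP; rewrite -ltNge.
Qed.

Lemma test_function_partial eta j : test_function eta -> test_function (partial j eta).
Proof.
move=> /test_functionP[se [M eM]]; apply/test_functionP; split.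
  exact: smooth_partial.
by exists M; exact: partial_support.
Qed.

Lemma test_function_translate eta (v : 'rV[R]_n) :
  test_function eta -> test_function (fun x => eta (x + v)).
Proof.
move=> /test_functionP[se [M eM]]; apply/test_functionP; split.
  exact: smooth_translate.
exists (M + `|v|) => x /eM h.
by rewrite -[x](addrK v) (le_trans (ler_normB _ _))// lerD2r.
Qed.

Lemma test_function0 : test_function (fun _ : 'rV[R]_n => 0).
Proof.
apply/test_functionP; split; first exact: smooth_cst.
by exists 0 => x; rewrite eqxx.
Qed.

Lemma test_functionDZ (a : R) f g : test_function f -> test_function g ->
  test_function (fun x => a * f x + g x).
Proof.
move=> /test_functionP[sf [M fM]] /test_functionP[sg [N gN]].
apply/test_functionP; split.
  exact: (smoothD (smoothM (smooth_cst a) sf) sg).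
exists (Num.max M N) => x; rewrite le_max; apply: contraNT; rewrite negb_or.
move=> /andP[hM hN]; have fx0 : f x = 0 by apply/eqP; apply: contraNT hM; exact: fM.
have gx0 : g x = 0 by apply/eqP; apply: contraNT hN; exact: gN.
by rewrite fx0 gx0 mulr0 addr0.
Qed.

Lemma smooth_continuous f : smooth f -> continuous f.
Proof. by move=> sf; have [] := sf [::]. Qed.

Lemma smooth_derivable f j x : smooth f -> derivable f x (e_ j).
Proof. by move=> sf; have [_] := sf [::]; exact. Qed.

Lemma partialDZ (a : R) f g j : smooth f -> smooth g ->
  partial j (fun x => a * f x + g x) = fun x => a * partial j f x + partial j g x.
Proof.
move=> sf sg; apply/funext => x; rewrite /partial.
have df : derivable f x (e_ j) by exact: smooth_derivable.
have dg : derivable g x (e_ j) by exact: smooth_derivable.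
by rewrite (deriveD (derivableZ df) dg) (deriveZ _ df).
Qed.

Lemma smooth_mean_value f j x (a b : R) : smooth f -> a <= b ->
  exists2 c, a <= c <= b & f (b *: e_ j + x) - f (a *: e_ j + x) =
    partial j f (c *: e_ j + x) * (b - a).
Proof.
move=> sf ab.
have d (t : R) : is_derive t (1 : R) (fun s => f (s *: e_ j + x)) (partial j f (t *: e_ j + x)).
  by apply: line_is_derive => y; exact: smooth_derivable.
have [|c] := MVT_segment ab (fun t _ => d t).
  apply: continuous_subspaceT => t; apply: differentiable_continuous.
  by apply/derivable1_diffP; have [] := d t.
by rewrite in_itv; exists c.
Qed.

(** Two applications of the mean value theorem.  The quadratic error, uniform
    in x, replaces limits of difference quotients everywhere below. *)
Lemma smooth_taylor f j x (h C : R) : smooth f -> 0 <= h ->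
  (forall y, `|partial j (partial j f) y| <= C) ->
  `|f x - f (x - h *: e_ j) - h * partial j f x| <= C * h ^+ 2.
Proof.
move=> sf h0 fC; set y := x - h *: e_ j.
have yx : h *: e_ j + y = x by rewrite addrC subrK.
have [c /andP[c0 ch]] := smooth_mean_value j y sf h0.
rewrite scale0r add0r yx subr0 => ->.
have [b _] := smooth_mean_value j y (smooth_partial j sf) ch; rewrite yx.
move=> /(congr1 (fun r => partial j f x - r)); rewrite subKr => ->.
rewrite (_ : _ - _ = - (h * (h - c)) * partial j (partial j f) (b *: e_ j + y)); last by ring.
rewrite normrM normrN normrM (ger0_norm h0) ger0_norm ?subr_ge0//.
have := fC (b *: e_ j + y); have := normr_ge0 (partial j (partial j f) (b *: e_ j + y)).
set p := `|partial _ _ _|; move=> p0 pC.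
apply: (@le_trans _ _ (h * h * p)).
  by rewrite ler_wpM2r// ler_wpM2l// gerBl.
by rewrite -expr2 mulrC ler_wpM2r// sqr_ge0.
Qed.

End smooth_functions.

(** * Test functions are total *)

Section density.
Context d (T : measurableType d) (R : realType).
Variable mu : {measure set T -> \bar R}.
Variable f : T -> \bar R.

Definition density (mf : measurable_fun setT f) (f0 : forall x, (0 <= f x)%E) :
  set T -> \bar R := fun A => (\int[mu]_(x in A) f x)%E.

Hypotheses (mf : measurable_fun setT f) (f0 : forall x, (0 <= f x)%E).

Local Notation nu := (density mf f0).

Let nu0 : nu set0 = 0%E. Proof. exact: integral_set0. Qed.

Let nu_ge0 A : (0 <= nu A)%E. Proof. exact: integral_ge0. Qed.

Let nu_sigma_additive : semi_sigma_additive nu.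
Proof. exact: semi_sigma_additive_nng_induced. Qed.

HB.instance Definition _ := isMeasure.Build _ _ _ nu nu0 nu_ge0 nu_sigma_additive.

End density.

Section fundamental_lemma.
Context (R : realType) (n : nat).
Local Notation mu := (rV_lebesgue R n).
Implicit Types (f v eta : 'rV[R]_n -> R).

Lemma bounded_support_sqint f (C : R) a b : measurable_fun setT f ->
  (forall x, `|f x| <= C) -> (forall x, f x != 0 -> box a b x) ->
  sqint mu f /\ ip mu f f <= C ^+ 2 * fine (mu (box a b)).
Proof.
move=> mf fC fab.
have bfin : mu (box a b) \is a fin_num by rewrite ge0_fin_numE// rV_lebesgue_box_lty.
have h : (\int[mu]_x (f x ^+ 2)%:E <= (C ^+ 2 * fine (mu (box a b)))%:E)%E.
  have mb := measurable_rV_box a b.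
  have mi : measurable_fun setT (\1_(box a b) : 'rV[R]_n -> R) by exact: measurable_indic.
  rewrite EFinM fineK//.
  have -> : mu (box a b) = (\int[mu]_x (\1_(box a b) x)%:E)%E.
    by rewrite integral_indic// setIT.
  rewrite -ge0_integralZl_EFin//; last 2 first.
  - exact/measurable_EFinP.
  - exact: sqr_ge0.
  apply: ge0_le_integral => //.
  - by move=> x _; rewrite lee_fin sqr_ge0.
  - by apply/measurable_EFinP; exact: measurable_funX.
  - by apply/measurable_EFinP; exact: measurable_funM.
  - move=> x _; rewrite -EFinM lee_fin; have [->|/fab h] := eqVneq (f x) 0.
      by rewrite expr0n/= mulr_ge0// sqr_ge0.
    rewrite indicE mem_set// mulr1 -real_normK ?num_real//.
    by rewrite lerXn2r// nnegrE (le_trans _ (fC x)).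
have sf : sqint mu f by split => //; exact: le_lt_trans h (ltry _).
by split=> //; rewrite -lee_fin -ipEFin.
Qed.

Lemma test_function_measurable eta : test_function eta -> measurable_fun setT eta.
Proof. by move=> [/smooth_continuous /continuous_measurable_rV]. Qed.

Lemma test_function_sqint eta : test_function eta -> sqint mu eta.
Proof.
move=> te; have /test_functionP[se [M eM]] := te.
have [C C0 eC] := bounded_of_bounded_support (smooth_continuous se) eM.
have sup x : eta x != 0 -> cube `|M| x.
  by move=> /eM xM; apply/cubeE => //; rewrite (le_trans xM)// ler_norm.
by have [] := bounded_support_sqint (test_function_measurable te) eC sup.
Qed.

(** Smooth functions of s that increase to 1 on the closed interval [a, b] and
    vanish outside of [a - 1/K, b + 1/K], with K = k + 1: the argument of each
    factor is K + K^2 times the signed distance of s to an endpoint. *)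
Definition bump1 (k : nat) (a b s : R) : R :=
  flatexp 1 (k.+1%:R ^+ 2 * s + (k.+1%:R - k.+1%:R ^+ 2 * a)) *
  flatexp 1 (- k.+1%:R ^+ 2 * s + (k.+1%:R + k.+1%:R ^+ 2 * b)).

Definition bump (k : nat) (a b x : 'rV[R]_n) : R :=
  \prod_(i < n) bump1 k (a ord0 i) (b ord0 i) (x ord0 i).

Lemma flatexp1_itv (t : R) : 0 <= flatexp 1 t <= 1.
Proof.
rewrite /flatexp; case: ifPn => [t0|_]; last by rewrite lexx ler01.
by rewrite hornerC mul1r expR_ge0 -[leRHS]expR0 ler_expR oppr_le0 invr_ge0 ltW.
Qed.

Lemma flatexp1_near1 (k : nat) (t : R) : k.+1%:R <= t -> 1 - k.+1%:R^-1 <= flatexp 1 t.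
Proof.
move=> kt; have k0 : 0 < k.+1%:R :> R by rewrite ltr0n.
have t0 : 0 < t by exact: lt_le_trans kt.
rewrite /flatexp t0 hornerC mul1r; apply: le_trans (expR_ge1Dx _).
by rewrite lerD2l lerN2 lef_pV2.
Qed.

Lemma bump1_itv k a b s : 0 <= bump1 k a b s <= 1.
Proof.
rewrite /bump1; set p := flatexp _ _; set q := flatexp _ _.
have /andP[p0 p1] : 0 <= p <= 1 := flatexp1_itv _.
have /andP[q0 q1] : 0 <= q <= 1 := flatexp1_itv _.
by rewrite mulr_ge0//= mulr_ile1.
Qed.

Lemma bump1_support k a b s : bump1 k a b s != 0 -> a - 1 <= s <= b + 1.
Proof.
rewrite mulf_eq0 negb_or /flatexp => /andP[].
have k0 : 1 <= k.+1%:R :> R by rewrite ler1n.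
case: ifPn => [h1 _|]; last by rewrite eqxx.
case: ifPn => [h2 _|]; last by rewrite eqxx.
by move: k.+1%:R h1 h2 k0 => K h1 h2 k0; apply/andP; split; nra.
Qed.

Lemma bump1_cvg a b s :
  bump1 k a b s @[k --> \oo] --> ((a <= s <= b)%R%:R : R).
Proof.
have outside t : 0 < t -> \forall k \near \oo,
    flatexp 1 (k.+1%:R - k.+1%:R ^+ 2 * t) = (0 : R).
  move=> t0; near=> k; rewrite /flatexp ifF//; apply/negbTE.
  have tk : t^-1 < k.+1%:R.
    apply: lt_trans (_ : k%:R < _); last by rewrite ltr_nat.
    by near: k; exact: nbhs_infty_gtr.
  have k0 : 0 < k.+1%:R :> R by rewrite ltr0n.
  have h : 1 < k.+1%:R * t by rewrite -ltr_pdivrMr// div1r.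
  by rewrite -leNgt subr_le0 expr2 -mulrA ler_peMr// ltW.
have cst_cvg (u : R^nat) : (\forall k \near \oo, u k = 0) -> u @ \oo --> (0 : R).
  move=> u0; apply: cvg_trans (_ : cst (0:R) @ \oo --> (0 : R)); last exact: cvg_cst.
  by apply: near_eq_cvg; apply: filterS u0 => k ->.
case: (leP a s) => [as_|sa]; last first.
  apply: cst_cvg; have as0 : 0 < a - s by rewrite subr_gt0.
  apply: filterS (outside _ as0) => k E; rewrite /bump1 (_ : _ ^+ 2 * s + _ = k.+1%:R - k.+1%:R ^+ 2 * (a - s)); last by ring.
  by rewrite E mul0r.
case: (leP s b) => [sb|bs]; last first.
  apply: cst_cvg; have bs0 : 0 < s - b by rewrite subr_gt0.
  apply: filterS (outside _ bs0) => k E; rewrite /bump1 mulrC.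
  rewrite (_ : - _ ^+ 2 * s + _ = k.+1%:R - k.+1%:R ^+ 2 * (s - b)); last by ring.
  by rewrite E mul0r.
have c1 : (fun k => 1 - k.+1%:R^-1) @ \oo --> (1 : R).
  rewrite -[X in _ --> X]subr0; apply: cvgB; first exact: cvg_cst.
  exact: cvg_harmonic.
apply: (@squeeze_cvgr _ _ _ _ (fun k => (1 - k.+1%:R^-1) * (1 - k.+1%:R^-1)) (cst 1)).
- apply: nearW => k; have /andP[_ ->] := bump1_itv k a b s; rewrite andbT.
  have k0 : 1 <= k.+1%:R :> R by rewrite ler1n.
  have k1 : 0 <= 1 - k.+1%:R^-1 :> R by rewrite subr_ge0 invf_le1// ltr0n.
  by apply: ler_pM => //; apply: flatexp1_near1; move: k.+1%:R k0 => K K0; nra.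
- by rewrite -[X in _ --> X]mulr1; exact: cvgM.
- exact: cvg_cst.
Unshelve. all: by end_near. Qed.

Lemma bump_cvg a b x : bump k a b x @[k --> \oo] --> (\1_(box a b) x : R).
Proof.
have -> : \1_(box a b) x = \prod_(i < n) (a ord0 i <= x ord0 i <= b ord0 i)%R%:R :> R.
  rewrite indicE; case: (boolP (x \in _)) => [|/negP].
    by rewrite inE => h; rewrite big1// => i _; rewrite h.
  rewrite inE => h; have [i hi] : exists i, ~~ (a ord0 i <= x ord0 i <= b ord0 i).
    by apply: contrapT => h'; apply: h => i; apply/negP => hi; apply: h'; exists i; apply/negP.
  by rewrite (bigD1 i)//= (negbTE hi) mul0r.
apply: (@cvg_big _ _ (@GRing.mul R) 1 xpredT) => [|i _]; last exact: bump1_cvg.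
exact: mul_continuous.
Qed.

Lemma bump_support k a b x : bump k a b x != 0 ->
  box (a - const_mx 1) (b + const_mx 1) x.
Proof.
move=> h i; rewrite !mxE; apply: (@bump1_support k); apply: contraNneq h => h.
by rewrite /bump (bigD1 i)//= h mul0r.
Qed.

Lemma bump_itv k a b x : 0 <= bump k a b x <= 1.
Proof.
apply/andP; split.
  by apply: prodr_ge0 => i _; have /andP[] := bump1_itv k (a ord0 i) (b ord0 i) (x ord0 i).
apply: (@le_trans _ _ (\prod_(i < n) 1)); last by rewrite big1.
by apply: ler_prod => i _; exact: bump1_itv.
Qed.

Lemma bump_test_function k a b : test_function (bump k a b).
Proof.
apply/test_functionP; split.
  apply: smooth_prod => i; apply: smoothM; exact: smooth_flatexp_coord.
exists (`|a| + `|b| + 1) => x /bump_support h.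
apply/cubeE; first by rewrite !addr_ge0.
have /cubeP ha : cube `|a| a by apply/cubeE.
have /cubeP hb : cube `|b| b by apply/cubeE.
apply/cubeP => i; move: (h i) (ha i) (hb i); rewrite !mxE !ler_norml.
move=> /andP[h1 h2] /andP[h3 h4] /andP[h5 h6].
have := normr_ge0 a; have := normr_ge0 b => h7 h8.
by apply/andP; split; lra.
Qed.

Lemma sqint_box a b : sqint mu (\1_(box a b) : 'rV[R]_n -> R).
Proof.
have [] // := @bounded_support_sqint (\1_(box a b) : 'rV[R]_n -> R) 1 a b.
- by apply: measurable_indic; exact: measurable_rV_box.
- by move=> x; rewrite indicE; case: (_ \in _); rewrite ?normr1 ?normr0.
- by move=> x; rewrite indicE; case: (boolP (x \in _)); rewrite ?inE// eqxx.
Qed.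

(** Dominated convergence, along bumps that converge to the indicator of the
    box. *)
Lemma orthogonal_box v a b : sqint mu v ->
  (forall eta, test_function eta -> ip mu v eta = 0) ->
  (\int[mu]_x (v x * \1_(box a b) x)%:E = 0)%E.
Proof.
move=> sv vo.
pose B := box (a - const_mx 1) (b + const_mx 1).
have mv : measurable_fun setT v by case: sv.
have mbump k := test_function_measurable (bump_test_function k a b).
have [] := @dominated_convergence _ _ R mu setT measurableT
  (fun k x => (v x * bump k a b x)%:E) (fun x => (v x * \1_(box a b) x)%:E)
  (fun x => `|v x * \1_B x|%:E).
- by move=> k; apply/measurable_EFinP; exact: measurable_funM.
- apply/measurable_EFinP/measurable_funM => //.
  by apply: measurable_indic; exact: measurable_rV_box.
- apply: aeW => x _; apply: cvg_EFin; first exact: nearW.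
  by apply: cvgM; [exact: cvg_cst|exact: bump_cvg].
- exact: (integrable_norm (sqint_integrable_mul sv (sqint_box _ _))).
- apply: aeW => x k _ /=; rewrite lee_fin !normrM ler_wpM2l//.
  have /andP[h0 h1] := bump_itv k a b x.
  rewrite (ger0_norm h0) indicE; have [bx0|/bump_support bx] := eqVneq (bump k a b x) 0.
    by rewrite bx0.
  by rewrite mem_set// normr1.
move=> _ _.
rewrite (_ : [sequence _]_n = cst 0%E).
  by move=> /cvg_lim <-//; rewrite lim_cst.
apply/funext => k /=.
have := sqint_integrable_mul sv (test_function_sqint (bump_test_function k a b)).
move=> /integrable_fin_num => /(_ measurableT) /fineK <-.
by congr (_%:E); exact: (vo _ (bump_test_function k a b)).
Qed.

(** The positive and negative parts of v have the same integral on each box,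
    hence on each measurable set by uniqueness of measures, in particular on
    the set where v is nonnegative and on its complement. *)
Lemma test_function_total v : sqint mu v ->
  (forall eta, test_function eta -> ip mu v eta = 0) -> ip mu v v = 0.
Proof.
move=> sv vo; have mv : measurable_fun setT v by case: sv.
pose f x := (v x)%:E.
have mf : measurable_fun setT f by exact/measurable_EFinP.
have mfp : measurable_fun setT f^\+%E by exact: measurable_funepos.
have mfn : measurable_fun setT f^\-%E by exact: measurable_funeneg.
pose nup : {measure set 'rV[R]_n -> \bar R} := density mu mfp (funepos_ge0 f).
pose nun : {measure set 'rV[R]_n -> \bar R} := density mu mfn (funeneg_ge0 f).
have ibox a b : mu.-integrable (box a b) f.
  have mb := measurable_rV_box a b.
  have := sqint_integrable_mul sv (sqint_box a b).
  move=> /(integrableS measurableT mb) => /(_ (@subsetT _ _)).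
  apply: eq_integrable => // x; rewrite inE => bx.
  by rewrite /= indicE mem_set// mulr1.
have pn a b : nup (box a b) = nun (box a b).
  have mb := measurable_rV_box a b.
  have := orthogonal_box a b sv vo.
  have -> : (\int[mu]_x (v x * \1_(box a b) x)%:E = \int[mu]_(x in box a b) f x)%E.
    rewrite [RHS]integral_mkcond; apply: eq_integral => x _.
    rewrite patchE indicE; case: ifPn => _; first by rewrite mulr1.
    by rewrite mulr0.
  rewrite integralE => E; rewrite /nup /nun /= /density.
  rewrite -(subeK (\int[mu]_(x in _) f^\+ x)%E (integrable_neg_fin_num mb (ibox a b))).
  by rewrite E add0e.
have eqpn A : measurable A -> nup A = nun A.
  apply: rV_measure_unique; first exact: pn.
  move=> k; have h := integrable_pos_fin_num (measurable_rV_box _ _) (ibox (const_mx (- k%:R)) (const_mx k%:R)).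
  by rewrite -ge0_fin_numE.
pose P := [set x | 0 <= v x].
have mP : measurable P.
  by rewrite -[P]setTI; exact: measurable_fun_le.
have int0 g (A : set 'rV[R]_n) : (forall x, A x -> g x = 0%E) -> (\int[mu]_(x in A) g x = 0)%E.
  by move=> g0; rewrite (eq_integral (cst 0%E)) ?integral0// => x; rewrite inE => /g0.
have fn0 x : P x -> f^\-%E x = 0%E.
  by move=> Px; rewrite funenegE /f -EFinN -EFin_max; congr (_%:E); apply/max_idPr; rewrite oppr_le0.
have fp0 x : ~ P x -> f^\+%E x = 0%E.
  move=> /negP; rewrite -ltNge => Px; rewrite funeposE /f -EFin_max; congr (_%:E).
  by apply/max_idPr; exact: ltW.
have ip0 : (\int[mu]_(x in P) f^\+ x = 0)%E.
  have := eqpn _ mP; rewrite /= /density => ->; exact: int0.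
have in0 : (\int[mu]_(x in ~` P) f^\- x = 0)%E.
  have := eqpn _ (measurableC mP); rewrite /= /density => <-; exact: int0.
have intv : (\int[mu]_x `|f x| = 0)%E.
  rewrite -[setT](setUv P) ge0_integral_setU//; last 3 first.
  - exact: measurableC.
  - by rewrite setUv; exact: measurableT_comp.
  - exact/disj_setPCl.
  rewrite (eq_integral f^\+%E); last first.
    move=> x; rewrite inE => Px; rewrite funeposE /f /= -EFin_max; congr (_%:E).
    by rewrite ger0_norm//; apply/esym/max_idPl.
  rewrite ip0 add0e (eq_integral f^\-%E) ?in0// => x; rewrite inE => /negP.
  rewrite -ltNge => Px; rewrite funenegE /f /= -EFin_max; congr (_%:E).
  by rewrite ltr0_norm//; apply/esym/max_idPl; rewrite oppr_ge0 ltW.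
have /ae_eq_integral_abs := intv => /(_ measurableT mf) fae.
rewrite /ip /Rintegral (ae_eq_integral (cst 0%E)) ?integral0//.
  by apply/measurable_EFinP; exact: measurable_funM.
by apply: filterS fae => x /(_ I) [->] _; rewrite mul0r.
Qed.

End fundamental_lemma.

(** * Difference quotients and weak derivatives *)

(** Telescoping along N equal steps leaves the error K h^2 / N. *)
Lemma small_increments (R : realType) (F : R -> R) (B K : R) : 0 <= K ->
  (forall s t, 0 <= t <= 1 -> `|F (s + t) - F s| <= B * t + K * t ^+ 2) ->
  forall h, 0 <= h -> `|F h - F 0| <= B * h.
Proof.
move=> K0 FB h h0.
have step N : h / N.+1%:R <= 1 -> `|F h - F 0| <= B * h + K * h ^+ 2 / N.+1%:R.
  move=> hN; set t := h / N.+1%:R.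
  have t0 : 0 <= t by rewrite divr_ge0.
  have Nt : N.+1%:R * t = h by rewrite mulrC divfK.
  have tele k : `|F (k%:R * t) - F 0| <= k%:R * (B * t + K * t ^+ 2).
    elim: k => [|k IH]; first by rewrite !mul0r subrr normr0.
    rewrite -natr1 !mulrDl !mul1r.
    have h1 := FB (k%:R * t) t; rewrite t0 hN in h1.
    apply: le_trans (lerD IH (h1 isT)).
    rewrite (_ : F _ - F 0 = (F (k%:R * t) - F 0) + (F (k%:R * t + t) - F (k%:R * t))).
      exact: ler_normD.
    by ring.
  have := tele N.+1; rewrite Nt => /le_trans; apply.
  rewrite mulrDr le_eqVlt; apply/orP; left; apply/eqP.
  have N0 : N.+1%:R != 0 :> R by rewrite pnatr_eq0.
  by rewrite /t; move: N.+1%:R N0 => q q0; field.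
rewrite leNgt; apply/negP => lt; set e := `|F h - F 0| - B * h.
have e0 : 0 < e by rewrite subr_gt0.
have Q0 : 0 <= h + K * h ^+ 2 / e.
  by rewrite addr_ge0// divr_ge0 ?mulr_ge0 ?sqr_ge0// ltW.
have := archi_boundP Q0; set n := Num.bound _ => nQ.
have nn : n%:R < n.+1%:R :> R by rewrite ltr_nat.
have n0 : 0 < n.+1%:R :> R by rewrite ltr0n.
have := step n; rewrite ler_pdivrMr// mul1r.
have q0 : 0 <= K * h ^+ 2 / e by rewrite divr_ge0 ?mulr_ge0 ?sqr_ge0// ltW.
have hn := lt_trans nQ nn.
have -> : h <= n.+1%:R by rewrite ltW// (le_lt_trans _ hn)// lerDl.
move=> /(_ isT); apply/negP; rewrite -ltNge -ltrBrDl ltr_pdivrMr//.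
by rewrite -/e [ltRHS]mulrC -ltr_pdivrMr// (le_lt_trans _ hn)// lerDr.
Qed.

Lemma le_of_quadratic_error (R : realType) (a b K t0 : R) : 0 < t0 -> 0 <= K ->
  (forall h, 0 < h <= t0 -> h * a <= h * b + K * h ^+ 2) -> a <= b.
Proof.
move=> t00 K0 H; rewrite leNgt; apply/negP => ab.
pose h := Num.min t0 ((a - b) / (2 * (K + 1))).
have h0 : 0 < h by rewrite lt_min t00 divr_gt0// ?subr_gt0//; lra.
have h1 : h <= t0 by rewrite ge_min lexx.
have : h <= (a - b) / (2 * (K + 1)) by rewrite ge_min lexx orbT.
rewrite ler_pdivlMr; last lra.
have := H h; rewrite h0 h1 => /(_ isT).
rewrite expr2 mulrCA -mulrDr ler_pM2l//.
by nra.
Qed.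

Section difference_quotients.
Context (R : realType) (n : nat).
Local Notation mu := (rV_lebesgue R n).
Local Notation sqint := (sqint mu).
Local Notation ip := (ip mu).
Local Notation e_ j := (delta_mx ord0 j : 'rV[R]_n).
Implicit Types (u v w g eta : 'rV[R]_n -> R) (j : 'I_n) (x : 'rV[R]_n).

(** The functional eta |-> ip v eta is represented by some G with ip G G <= C,
    and v - G is orthogonal to all test functions, hence null. *)
Lemma dual_bound v (C : R) : 0 <= C -> sqint v ->
  (forall eta, test_function eta -> ip v eta ^+ 2 <= C * ip eta eta) -> ip v v <= C.
Proof.
move=> C0 sv vC.
have tsq : @test_function R n `<=` sqint by move=> eta; exact: test_function_sqint.
have [|G sG [GC Gv]] := @riesz_subspace _ _ R mu (@test_function R n) (ip v) C C0
  (@test_function0 R n) (@test_functionDZ R n) tsq _ vC.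
  by move=> a f g /tsq sf /tsq sg; rewrite ipC ipDZl// !(ipC _ v).
have sd : sqint (fun x => v x - G x) by exact: sqintB.
have d0 : ip (fun x => v x - G x) (fun x => v x - G x) = 0.
  apply: test_function_total => // eta te; rewrite ipBl//; last exact: tsq.
  by rewrite Gv// subrr.
have d1 w : sqint w -> ip v w = ip G w.
  move=> sw; apply/eqP; rewrite -subr_eq0 -ipBl// -sqrf_eq0 eq_le sqr_ge0 andbT.
  by have := ip_CauchySchwarz sd sw; rewrite d0 mul0r.
by rewrite d1// ipC d1.
Qed.

Lemma integral_rV_translate (v : 'rV[R]_n) (f : 'rV[R]_n -> \bar R) :
  measurable_fun setT f -> (\int[mu]_x f (x + v)%R = \int[mu]_x f x)%E.
Proof.
have ge0 (g : 'rV[R]_n -> \bar R) : measurable_fun setT g -> (forall x, 0 <= g x)%E ->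
    (\int[mu]_x g (x + v)%R = \int[mu]_x g x)%E.
  move=> mg g0.
  have := @ge0_integral_pushforward _ _ _ _ R _ (measurable_rV_translate v) mu setT g
    measurableT mg (fun x _ => g0 x).
  rewrite preimage_setT => <-; apply: eq_measure_integral => [|mt A mA _].
    exact: measurable_rV_translate.
  exact: rV_lebesgue_translate.
move=> mf; rewrite integralE [RHS]integralE; congr (_ - _)%E.
  rewrite -(ge0 _ (measurable_funepos mf))//.
  by apply: eq_integral => x _; rewrite !funeposE.
rewrite -(ge0 _ (measurable_funeneg mf))//.
by apply: eq_integral => x _; rewrite !funenegE.
Qed.

Lemma sqint_translate u (v : 'rV[R]_n) : sqint u -> sqint (fun x => u (x + v)).
Proof.
move=> [mu1 fu]; split.
  exact: (measurableT_comp mu1 (measurable_rV_translate v)).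
rewrite (integral_rV_translate v (f := fun x => (u x ^+ 2)%:E))//.
by apply/measurable_EFinP; exact: measurable_funX.
Qed.

Lemma ip_translate u w (v : 'rV[R]_n) : sqint u -> sqint w ->
  ip (fun x => u (x + v)) (fun x => w (x + v)) = ip u w.
Proof.
move=> [mu1 _] [mw _]; rewrite /ip /Rintegral.
rewrite (integral_rV_translate v (f := fun x => (u x * w x)%:E))//.
by apply/measurable_EFinP; exact: measurable_funM.
Qed.

(** For t <= 1 the remainders are supported in a common cube, so that the
    pointwise bound becomes a bound in L^2. *)
Lemma taylor_remainder_sqint eta j : test_function eta ->
  exists2 K : R, 0 <= K & forall t : R, 0 <= t <= 1 ->
    let r := fun x => eta x - eta (x - t *: e_ j) - t * partial j eta x in
    sqint r /\ ip r r <= (K * t ^+ 2) ^+ 2.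
Proof.
move=> te; have /test_functionP[se [M eM]] := te.
have sp := smooth_partial j se; have spp := smooth_partial j sp.
have [C C0 hC] := bounded_of_bounded_support (smooth_continuous spp)
  (partial_support (partial_support eM)).
pose k : R := `|M| + 1.
pose V : R := fine (mu (cube k)).
have V0 : 0 <= V by rewrite fine_ge0.
exists (C * Num.sqrt V) => [|t /andP[t0 t1] r]; first by rewrite mulr_ge0 ?sqrtr_ge0.
have sr : sqint r.
  apply: sqintB; last by apply/sqintZ/test_function_sqint/test_function_partial.
  apply: sqintB; first exact: test_function_sqint.
  by apply/test_function_sqint/test_function_translate.
have rC x : `|r x| <= C * t ^+ 2 by exact: smooth_taylor.
have rk x : r x != 0 -> cube k x.
  apply: contraNP => xk; have Mx : `|M| + 1 < `|x|.
    rewrite ltNge; apply/negP => h; apply: xk; apply/cubeE => //.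
    by rewrite addr_ge0.
  have zero (f : 'rV[R]_n -> R) (y : 'rV[R]_n) : (forall z, f z != 0 -> `|z| <= M) -> M < `|y| -> f y = 0.
    by move=> fM; rewrite ltNge => yM; apply/eqP; apply: contraNT yM; exact: fM.
  have MM := ler_norm M.
  rewrite /r (zero eta x eM); last lra.
  rewrite (zero (partial j eta) x (partial_support eM)); last lra.
  rewrite (zero eta _ eM) ?subr0 ?mulr0 ?subr0//.
  have h1 : `|x| <= `|x - t *: e_ j| + `|t *: e_ j|.
    by rewrite -[X in `|X| <= _](subrK (t *: e_ j)) ler_normD.
  have h2 : `|t *: e_ j| <= 1.
    apply/cubeE => //; apply/cubeP => i; rewrite !mxE eqxx /=.
    by case: (_ == _); rewrite ?mulr1 ?mulr0 ?normr0// ger0_norm.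
  lra.
have mr : measurable_fun setT r by case: sr.
have [_ ir] := bounded_support_sqint mr rC rk.
by split=> //; rewrite mulrAC exprMn sqr_sqrtr.
Qed.

Definition incr j (h : R) u : 'rV[R]_n -> R := fun x => u (x + h *: e_ j) - u x.

Lemma sqint_incr j h u : sqint u -> sqint (incr j h u).
Proof. by move=> su; apply: sqintB => //; exact: sqint_translate. Qed.

(** Discrete integration by parts, from the translation invariance of the
    measure. *)
Lemma ip_incr j h u eta : sqint u -> test_function eta ->
  ip (incr j h u) eta = - ip u (fun x => eta x - eta (x - h *: e_ j)).
Proof.
move=> su te; have se := test_function_sqint te.
have st := sqint_translate (- (h *: e_ j)) se.
rewrite ipBl//; last exact: sqint_translate.
rewrite [ip u _]ipC [X in _ = - X]ipC ipBl// opprB; congr (_ - _).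
rewrite -(ip_translate (h *: e_ j) st su) [RHS]ipC.
by congr ip; apply/funext => x; rewrite addrK.
Qed.

Lemma ip_le_sqrt u v (C : R) : 0 <= C -> ip u v ^+ 2 <= C -> `|ip u v| <= Num.sqrt C.
Proof.
move=> C0 h; rewrite -(@ler_pXn2r _ 2)// ?nnegrE ?sqrtr_ge0//.
by rewrite real_normK ?num_real// sqr_sqrtr.
Qed.

Lemma sqrtr_mul_sqr (a b : R) : 0 <= a -> 0 <= b ->
  Num.sqrt a * b = Num.sqrt (a * b ^+ 2).
Proof. by move=> a0 b0; rewrite sqrtrM// sqrtr_sqr ger0_norm. Qed.

(** Test against eta, and let F s be the pairing of u with the translate of eta
    by s.  The definition of g bounds each increment of F by |g| |eta| t up
    to a quadratic error, whence |F h - F 0| <= |g| |eta| h. *)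
Lemma weak_derivative_incr j u g (h : R) : sqint u -> sqint g ->
  (forall eta, test_function eta -> ip u (partial j eta) = - ip g eta) -> 0 <= h ->
  ip (incr j h u) (incr j h u) <= h ^+ 2 * ip g g.
Proof.
move=> su sg wug h0.
apply: dual_bound; [by rewrite mulr_ge0 ?sqr_ge0 ?ip_ge0|exact: sqint_incr|].
move=> eta te; have se := test_function_sqint te.
have [K K0 hK] := taylor_remainder_sqint j te.
pose B := Num.sqrt (ip g g * ip eta eta).
pose tr (s : R) := fun x => eta (x + - (s *: e_ j)).
have ttr s : test_function (tr s) by exact: test_function_translate.
pose F s := ip u (tr s).
have FB s t : 0 <= t <= 1 ->
    `|F (s + t) - F s| <= B * t + (Num.sqrt (ip u u) * K) * t ^+ 2.
  move=> /andP[t0 t1]; have := hK t; rewrite t0 t1 => /(_ isT) /=.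
  set r := fun x => _; move=> [sr ir].
  pose rs x := r (x + - (s *: e_ j)).
  have srs : sqint rs by exact: sqint_translate.
  have irs : ip rs rs <= (K * t ^+ 2) ^+ 2 by rewrite ip_translate.
  have sp : sqint (partial j (tr s)) by apply/test_function_sqint/test_function_partial.
  have E : F (s + t) - F s = - ip u rs - t * ip u (partial j (tr s)).
    rewrite /F ![ip u _]ipC -ipBl//; try exact: test_function_sqint.
    rewrite -opprD [in RHS]addrC -ipDZl// -mulN1r -ipZl//; last exact: sqintDZ.
    congr ip; apply/funext => x.
    rewrite /tr partial_translate /rs /r scalerDl opprD addrA; ring.
  rewrite E; apply: le_trans (ler_normB _ _) _; rewrite addrC; apply: lerD.
    rewrite wug// mulrN normrN normrM (ger0_norm t0) mulrC ler_wpM2r//.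
    apply: ip_le_sqrt; first by rewrite mulr_ge0 ?ip_ge0.
    have := ip_CauchySchwarz sg (test_function_sqint (ttr s)).
    by rewrite /tr ip_translate.
  rewrite normrN -mulrA sqrtr_mul_sqr ?ip_ge0 ?mulr_ge0 ?sqr_ge0//.
  apply: ip_le_sqrt; first by rewrite mulr_ge0 ?ip_ge0 ?sqr_ge0.
  apply: le_trans (ip_CauchySchwarz su srs) _.
  by rewrite ler_wpM2l ?ip_ge0.
have KK : 0 <= Num.sqrt (ip u u) * K by rewrite mulr_ge0 ?sqrtr_ge0.
have := small_increments KK FB h0.
have -> : F h - F 0 = ip (incr j h u) eta.
  rewrite ip_incr// /F ![ip u _]ipC -ipBl//; try exact: test_function_sqint.
  rewrite -mulN1r -ipZl//; last by apply: sqintB => //; apply: test_function_sqint; exact: ttr.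
  congr ip; apply/funext => x; rewrite /tr scale0r subr0; ring.
move=> hB; rewrite -real_normK ?num_real//.
have -> : h ^+ 2 * ip g g * ip eta eta = (B * h) ^+ 2.
  by rewrite exprMn sqr_sqrtr ?mulr_ge0 ?ip_ge0//; ring.
by rewrite lerXn2r ?nnegrE ?mulr_ge0 ?sqrtr_ge0.
Qed.

(** The pairing of w with the difference quotient of eta is the one of the
    difference quotient of w with eta; divide by h and let h tend to 0. *)
Lemma incr_weak_derivative j w (C : R) : 0 <= C -> sqint w ->
  (forall h, 0 < h -> ip (incr j h w) (incr j h w) <= h ^+ 2 * C) ->
  forall eta, test_function eta -> ip w (partial j eta) ^+ 2 <= C * ip eta eta.
Proof.
move=> C0 sw wC eta te; have se := test_function_sqint te.
have sp := test_function_sqint (test_function_partial j te).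
have [K K0 hK] := taylor_remainder_sqint j te.
pose B := Num.sqrt (C * ip eta eta).
suff : `|ip w (partial j eta)| <= B.
  move=> hB; rewrite -real_normK ?num_real//.
  rewrite -[leRHS]sqr_sqrtr ?mulr_ge0 ?ip_ge0//.
  by rewrite lerXn2r ?nnegrE ?sqrtr_ge0.
have KK : 0 <= Num.sqrt (ip w w) * K by rewrite mulr_ge0 ?sqrtr_ge0.
apply: (le_of_quadratic_error ltr01 KK) => h /andP[h0 h1].
have := hK h; rewrite (ltW h0) h1 => /(_ isT) /=.
set r := fun x => _; move=> [sr ir].
have E : h * ip w (partial j eta) = - ip (incr j h w) eta - ip w r.
  rewrite ip_incr// opprK ![ip w _]ipC -ipBl//; last first.
    by apply: sqintB => //; exact: sqint_translate.
  by rewrite -ipZl//; congr ip; apply/funext => x; rewrite /r; ring.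
rewrite -{1}(gtr0_norm h0) -normrM E; apply: le_trans (ler_normB _ _) _; apply: lerD.
  rewrite normrN [leRHS]mulrC (sqrtr_mul_sqr _ (ltW h0)) ?mulr_ge0 ?ip_ge0//.
  apply: ip_le_sqrt; first by rewrite mulr_ge0 ?sqr_ge0// mulr_ge0 ?ip_ge0.
  apply: le_trans (ip_CauchySchwarz (sqint_incr j h sw) se) _.
  by rewrite mulrAC ler_wpM2r ?ip_ge0// mulrC wC.
rewrite -mulrA (sqrtr_mul_sqr (ip_ge0 mu w) (mulr_ge0 K0 (sqr_ge0 h))).
apply: ip_le_sqrt; first by rewrite mulr_ge0 ?ip_ge0 ?sqr_ge0.
apply: le_trans (ip_CauchySchwarz sw sr) _.
by rewrite ler_wpM2l ?ip_ge0.
Qed.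

Lemma exists_weak_derivative j w (C : R) : 0 <= C -> sqint w ->
  (forall eta, test_function eta -> ip w (partial j eta) ^+ 2 <= C * ip eta eta) ->
  exists2 g, sqint g & forall eta, test_function eta -> ip w (partial j eta) = - ip g eta.
Proof.
move=> C0 sw wC.
have tsq : @test_function R n `<=` sqint by move=> eta; exact: test_function_sqint.
have [|G sG [_ Gw]] := @riesz_subspace _ _ R mu (@test_function R n)
  (fun eta => ip w (partial j eta)) C C0
  (@test_function0 R n) (@test_functionDZ R n) tsq _ wC.
  move=> a f g tf tg; have [sf _] := tf; have [sg _] := tg.
  have h1 := tsq _ (test_function_partial j tf).
  have h2 := tsq _ (test_function_partial j tg).
  by rewrite partialDZ// ipC ipDZl// !(ipC _ w).
exists (fun x => -1 * G x); first exact: sqintZ.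
by move=> eta te; rewrite ipZl//; [rewrite mulN1r opprK Gw|exact: tsq].
Qed.

End difference_quotients.

(** * Lipschitz images of complex Sobolev functions *)

Section ae_nonmeasurable.
Context d (T : measurableType d) (R : realType).
Variable mu : {measure set T -> \bar R}.
Local Open Scope ereal_scope.
Import HBNNSimple.

(** The potential V is only almost everywhere equal to a Borel function, so
    that V |phi|^2 need not be measurable.  The integral of a nonnegative
    function is a supremum over simple functions below it, which is insensitive
    to null sets. *)
Lemma ge0_integral_ae_eq_measurable (f g : T -> \bar R) :
  (forall x, 0 <= f x) -> (forall x, 0 <= g x) -> measurable_fun setT g ->
  {ae mu, forall x, f x = g x} -> \int[mu]_x f x = \int[mu]_x g x.
Proof.
move=> f0 g0 mg fg; apply/eqP; rewrite eq_le; apply/andP; split.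
  rewrite [leLHS]ge0_integralTE//; apply: ge_ereal_sup => _ [h /= hf <-].
  rewrite -integralT_nnsfun; apply: ae_ge0_le_integral => //.
  - by move=> x _; rewrite lee_fin.
  - exact/measurable_EFinP.
  - by apply: filterS fg => x <- _.
have [N [mN N0 subN]] := fg.
pose g' := g \_ (~` N).
have mg' : measurable_fun setT g'.
  apply/(measurable_restrictT _ (measurableC mN)).1; exact: measurable_funS mg.
have g'0 x : 0 <= g' x by rewrite /g' patchE; case: ifP.
have -> : \int[mu]_x g x = \int[mu]_x g' x.
  apply: ge0_ae_eq_integral => //; exists N; split => // x /= h.
  apply: contrapT => Nx; apply: h => _; rewrite /g' patchE ifT// inE.
  exact: Nx.
rewrite [leLHS]ge0_integralTE// [leRHS]ge0_integralTE//.
apply: ereal_sup_le => _ [h /= hg <-]; exists h => // x.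
apply: le_trans (hg x) _; rewrite /g' patchE; case: ifPn => // xN.
suff -> : f x = g x by [].
by apply: contrapT => h'; move: xN; rewrite inE; apply; exact: subN.
Qed.

End ae_nonmeasurable.

Section complex_L2.
Context (R : realType) (n : nat).
Local Notation mu := (rV_lebesgue R n).
Local Notation sqint := (sqint mu).
Local Notation ip := (ip mu).
Local Notation e_ j := (delta_mx ord0 j : 'rV[R]_n).
Implicit Types (phi psi : 'rV[R]_n -> R[i]) (w eta : 'rV[R]_n -> R) (j : 'I_n).

Definition re phi : 'rV[R]_n -> R := fun x => complex.Re (phi x).
Definition im phi : 'rV[R]_n -> R := fun x => complex.Im (phi x).
Definition ofreal w : 'rV[R]_n -> R[i] := fun x => Complex (w x) 0.

Lemma modulus_sqr (z : R[i]) : modulus z ^+ 2 = complex.Re z ^+ 2 + complex.Im z ^+ 2.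
Proof. by case: z => a b; rewrite /modulus /= sqr_sqrtr// addr_ge0 ?sqr_ge0. Qed.

Lemma modulus_ge0 (z : R[i]) : 0 <= modulus z.
Proof. by case: z => a b; rewrite sqrtr_ge0. Qed.

Lemma L2_sqint phi : L2 phi <-> sqint (re phi) /\ sqint (im phi).
Proof.
split=> [[mr mi fin]|[[mr fr] [mi fi]]].
  have mm : measurable_fun setT (fun x => (modulus (phi x) ^+ 2)%:E).
    under eq_fun do rewrite modulus_sqr.
    by apply/measurable_EFinP/measurable_funD; exact: measurable_funX.
  have aux (f : 'rV[R]_n -> R) : measurable_fun setT f ->
      (forall x, f x ^+ 2 <= modulus (phi x) ^+ 2) -> sqint f.
    move=> mf fphi; split => //; apply: le_lt_trans fin; apply: ge0_le_integral => //.
    - by move=> x _; rewrite lee_fin sqr_ge0.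
    - by apply/measurable_EFinP; exact: measurable_funX.
    - by move=> x _; rewrite lee_fin.
  by split; apply: aux => // x; rewrite modulus_sqr ?lerDl ?lerDr sqr_ge0.
split => //; under eq_integral do rewrite modulus_sqr EFinD.
rewrite ge0_integralD//.
- by rewrite lte_add_pinfty.
- by move=> x _; rewrite lee_fin sqr_ge0.
- by apply/measurable_EFinP; exact: measurable_funX.
- by move=> x _; rewrite lee_fin sqr_ge0.
- by apply/measurable_EFinP; exact: measurable_funX.
Qed.

Lemma ip0l eta : ip (fun=> 0) eta = 0.
Proof.
rewrite /ip /Rintegral (eq_integral (cst 0%E)) ?integral0// => x _.
by rewrite /= mul0r.
Qed.

Definition nsq phi : R := ip (re phi) (re phi) + ip (im phi) (im phi).

Lemma nsq_ge0 phi : 0 <= nsq phi.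
Proof. by rewrite addr_ge0 ?ip_ge0. Qed.

Lemma measurable_re phi : L2 phi -> measurable_fun setT (re phi).
Proof. by case. Qed.

Lemma measurable_im phi : L2 phi -> measurable_fun setT (im phi).
Proof. by case. Qed.

Lemma massE phi : L2 phi -> mass phi = (nsq phi)%:E.
Proof.
move=> /L2_sqint[sr si]; rewrite /mass.
under eq_integral do rewrite modulus_sqr EFinD.
rewrite ge0_integralD//.
- by rewrite [X in (X + _)%E](ipEFin sr) [X in (_ + X)%E](ipEFin si).
- by move=> x _; rewrite lee_fin sqr_ge0.
- by apply/measurable_EFinP; apply: measurable_funX; case: sr.
- by move=> x _; rewrite lee_fin sqr_ge0.
- by apply/measurable_EFinP; apply: measurable_funX; case: si.
Qed.

Lemma weak_gradientP phi : H1 phi -> is_weak_gradient phi (weak_gradient phi).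
Proof.
move=> [_ hg]; rewrite /weak_gradient.
have := xgetPex (fun _ _ => 0) (P := [set g | is_weak_gradient phi g]) hg.
by [].
Qed.

Lemma grad_sqnormE phi : H1 phi ->
  grad_sqnorm phi = (\sum_(j < n) nsq (weak_gradient phi j))%:E.
Proof.
move=> /weak_gradientP wg; rewrite /grad_sqnorm.
under eq_integral do rewrite -sumEFin.
rewrite ge0_integral_sum//.
- by rewrite -sumEFin; apply: eq_bigr => j _; have [/massE h _] := wg j; exact: h.
- move=> j; have [[mr mi _] _] := wg j; under eq_fun do rewrite modulus_sqr.
  by apply/measurable_EFinP/measurable_funD; exact: measurable_funX.
- by move=> j x _; rewrite lee_fin sqr_ge0.
Qed.

Lemma ofreal_L2 w : sqint w -> L2 (ofreal w).
Proof. by move=> sw; apply/L2_sqint; split => //; exact: sqint0. Qed.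

Lemma weak_gradient_incr phi j (h : R) : H1 phi -> 0 <= h ->
  ip (incr j h (re phi)) (incr j h (re phi)) +
  ip (incr j h (im phi)) (incr j h (im phi)) <= h ^+ 2 * nsq (weak_gradient phi j).
Proof.
move=> Hphi h0; have [/L2_sqint[sr si] _] := Hphi.
have [/L2_sqint[gr gi] wp] := weak_gradientP Hphi j.
rewrite mulrDr; apply: lerD; apply: weak_derivative_incr => // eta te.
  by have [] := wp eta te.
by have [] := wp eta te.
Qed.

(** The hypothesis passes to increments, hence to L^2 bounds on the difference
    quotients of w.  These bound every weak gradient of w, in particular the
    one selected by [weak_gradient]. *)
Lemma lipschitz_H1 w phi psi (a b : R) : 0 <= a -> 0 <= b ->
  H1 phi -> H1 psi -> sqint w ->
  (forall x y, (w x - w y) ^+ 2 <=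
     a * modulus (phi x - phi y) ^+ 2 + b * modulus (psi x - psi y) ^+ 2) ->
  H1 (ofreal w) /\ (grad_sqnorm (ofreal w) <=
    a%:E * grad_sqnorm phi + b%:E * grad_sqnorm psi)%E.
Proof.
move=> a0 b0 Hphi Hpsi sw wle.
have [/L2_sqint[sr si] _] := Hphi; have [/L2_sqint[sr' si'] _] := Hpsi.
pose C j := a * nsq (weak_gradient phi j) + b * nsq (weak_gradient psi j).
have C0 j : 0 <= C j by rewrite addr_ge0// mulr_ge0// nsq_ge0.
have incr_le j h : 0 < h -> ip (incr j h w) (incr j h w) <= h ^+ 2 * C j.
  move=> h0.
  have swi := sqint_incr j h sw.
  have sA1 := sqint_incr j h sr; have sA2 := sqint_incr j h si.
  have sB1 := sqint_incr j h sr'; have sB2 := sqint_incr j h si'.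
  apply: (@le_trans _ _ (a * (ip (incr j h (re phi)) (incr j h (re phi)) +
      ip (incr j h (im phi)) (incr j h (im phi))) +
    b * (ip (incr j h (re psi)) (incr j h (re psi)) +
      ip (incr j h (im psi)) (incr j h (im psi))))); last first.
    rewrite /C [leRHS]mulrDr !(mulrCA (h ^+ 2)); apply: lerD; rewrite ler_wpM2l//.
      by apply: weak_gradient_incr => //; exact: ltW.
    by apply: weak_gradient_incr => //; exact: ltW.
  have iA1 := sqint_integrable_mul sA1 sA1; have iA2 := sqint_integrable_mul sA2 sA2.
  have iB1 := sqint_integrable_mul sB1 sB1; have iB2 := sqint_integrable_mul sB2 sB2.
  have iA := integrableD measurableT iA1 iA2; have iB := integrableD measurableT iB1 iB2.
  have iaA := integrableZl measurableT a iA; have ibB := integrableZl measurableT b iB.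
  rewrite /ip -!RintegralD// -!RintegralZl// -RintegralD//.
  apply: le_Rintegral => //; first exact: sqint_integrable_mul.
    exact: (integrableD measurableT iaA ibB).
  move=> x _; have := wle (x + h *: e_ j) x; rewrite !modulus_sqr.
  by rewrite /incr /re /im !raddfB /= -!expr2.
have wC j := incr_weak_derivative (C0 j) sw (incr_le j).
have HG j := exists_weak_derivative (C0 j) sw (wC j).
have Hw : H1 (ofreal w).
  split; first exact: ofreal_L2.
  have /choice[G HG'] j : exists g, sqint g /\ forall eta, test_function eta ->
      ip w (partial j eta) = - ip g eta.
    by have [g sg hg] := HG j; exists g.
  exists (fun j => ofreal (G j)) => j; have [sG wG] := HG' j; split; first exact: ofreal_L2.
  move=> eta te; split; first exact: wG.
  change (ip (fun=> 0) (partial j eta) = - ip (fun=> 0) eta).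
  by rewrite !ip0l oppr0.
split => //.
rewrite !grad_sqnormE// -!EFinM -EFinD lee_fin !mulr_sumr -big_split/=.
apply: ler_sum => j _; rewrite -/(C j) -[C j]addr0.
have [/L2_sqint[gr gi] wp] := weak_gradientP Hw j.
apply: lerD; apply: dual_bound => // eta te.
  have [E _] := wp eta te; have := wC j eta te.
  have <- : - ip w (partial j eta) = ip (re (weak_gradient (ofreal w) j)) eta.
    by apply/eqP; rewrite eqr_oppLR; apply/eqP; exact: E.
  by rewrite sqrrN.
have [_ E] := wp eta te; rewrite mul0r.
have -> : ip (im (weak_gradient (ofreal w) j)) eta = 0.
  apply/eqP; rewrite -oppr_eq0; apply/eqP; rewrite -[LHS]E.
  exact: ip0l.
by rewrite expr0n.
Qed.

End complex_L2.

(** * The first variation at the ground state *)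

(** An upper bound on the power which is exact to first order at l = 1, and
    rational in l: ln l <= l - 1 and exp (- z) >= 1 - z. *)
Lemma powR_le_inv (R : realType) (l q : R) : 0 < l -> 0 <= q -> q * (l - 1) < 1 ->
  l `^ q <= (1 - q * (l - 1))^-1.
Proof.
move=> l0 q0 ql; rewrite /powR gt_eqF//.
have lnl : ln l <= l - 1.
  by have := expR_ge1Dx (ln l); rewrite lnK// ?posrE//; lra.
apply: (@le_trans _ _ (expR (q * (l - 1)))); first by rewrite ler_expR ler_wpM2l.
rewrite -[leLHS]invrK -expRN lef_pV2 ?posrE ?expR_gt0 ?subr_gt0//.
exact: expR_ge1Dx.
Qed.

(** With k = (M - m) / m one has l = 1 / (1 + t k), and the power of l is
    bounded by (1 + t k) / (1 + (1 + q) t k).  Clearing denominators leaves a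
    polynomial inequality in t without constant term, whose linear part is the
    claim. *)
Lemma first_variation (R : realType) (A0 A1 N0 N1 m M q : R) :
  1 <= q -> 0 < m -> 0 <= M -> 0 <= A0 -> 0 <= A1 -> 0 <= N0 -> 0 <= N1 ->
  (forall t, 0 < t < 1 -> let l := m / ((1 - t) * m + t * M) in
     A0 + N0 / q <= l * ((1 - t) * A0 + t * A1) +
                    l `^ q / q * ((1 - t) * N0 + t * N1)) ->
  (A0 + N0) / m * (M - m) <= (A1 + N1 / q) - (A0 + N0 / q).
Proof.
move=> q1 m0 M0 A00 A10 N00 N10 H.
have q0 : 0 < q by lra.
pose k := (M - m) / m.
have Mk : M = m * (1 + k) by rewrite /k; field; rewrite gt_eqF.
have -> : (A0 + N0) / m * (M - m) = k * (A0 + N0) by rewrite /k; field; rewrite gt_eqF.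
(* Below t0 both 1 + t k and 1 + (1 + q) t k are at least 1 / 2. *)
pose t0 := (2 * (2 + q) * (`|k| + 1))^-1.
have k0 := normr_ge0 k.
have D0 : 0 < 2 * (2 + q) * (`|k| + 1) by rewrite !mulr_gt0//; lra.
have t00 : 0 < t0 by rewrite invr_gt0.
have qi : 0 < q^-1 by rewrite invr_gt0.
(* Coefficients of t^2 and t^3 once the denominators are cleared. *)
pose c2 := (1 + q) * k * (A1 - A0) + (k ^+ 2 * N0 + 2 * k * (N1 - N0)) / q
  - (A0 + N0 / q) * (1 + q) * k ^+ 2.
pose c3 := k ^+ 2 * (N1 - N0) / q.
have K0 : 0 <= `|c2| + `|c3| by rewrite addr_ge0.
apply: (le_of_quadratic_error t00 K0) => t /andP[tp tt].
have tk : t * (2 * (2 + q) * (`|k| + 1)) <= 1.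
  by rewrite -ler_pdivlMr// div1r.
have t1 : t < 1 by nra.
have tkq : (2 + q) * (t * `|k|) <= 2^-1 by nra.
have nk : - `|k| <= k <= `|k| by rewrite -ler_norml.
have tkk : `|t * k| = t * `|k| by rewrite normrM gtr0_norm.
pose y := t * k.
have ny : - (t * `|k|) <= y <= t * `|k| by rewrite -ler_norml tkk.
have tk0 : 0 <= t * `|k| by rewrite mulr_ge0// ltW.
have D1 : 0 < 1 + y by nra.
have D2 : 0 < 1 + (1 + q) * y by nra.
have := H t; rewrite tp t1 => /(_ isT) /=.
have -> : m / ((1 - t) * m + t * M) = (1 + y)^-1.
  have -> : (1 - t) * m + t * M = m * (1 + y) by rewrite Mk /y; ring.
  by rewrite invfM mulrA divff ?mul1r// gt_eqF.
set l := (1 + y)^-1.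
have l0 : 0 < l by rewrite invr_gt0.
have lq : l `^ q <= (1 + y) / (1 + (1 + q) * y).
  have l1 : 1 - q * (l - 1) = (1 + (1 + q) * y) / (1 + y).
    by rewrite /l; field; rewrite gt_eqF.
  have := powR_le_inv l0 (ltW q0).
  rewrite l1 invf_div; apply.
  by rewrite -subr_gt0 l1 divr_gt0.
move=> H1.
have Nt0 : 0 <= (1 - t) * N0 + t * N1 by rewrite addr_ge0// mulr_ge0//; lra.
have H2 : A0 + N0 / q <= l * ((1 - t) * A0 + t * A1) +
    (1 + y) / (1 + (1 + q) * y) / q * ((1 - t) * N0 + t * N1).
  apply: le_trans H1 _; rewrite lerD2l ler_wpM2r// ler_wpM2r//; exact: ltW.
rewrite -(ler_pM2l (mulr_gt0 D1 D2)) in H2.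
move: H2; have -> : (1 + y) * (1 + (1 + q) * y) * (l * ((1 - t) * A0 + t * A1) +
    (1 + y) / (1 + (1 + q) * y) / q * ((1 - t) * N0 + t * N1)) =
  (1 + (1 + q) * y) * ((1 - t) * A0 + t * A1) + (1 + y) ^+ 2 / q * ((1 - t) * N0 + t * N1).
  by rewrite /l; field; rewrite !gt_eqF.
move=> H2.
have H3 : t * (k * (A0 + N0)) <= t * ((A1 + N1 / q) - (A0 + N0 / q)) + t ^+ 2 * c2 + t ^+ 3 * c3.
  rewrite -subr_ge0; move: H2; rewrite -subr_ge0.
  congr (0 <= _); rewrite /c2 /c3 /y; field; exact: lt0r_neq0.
apply: le_trans H3 _; rewrite -addrA lerD2l mulrDl; apply: lerD.
  by rewrite mulrC ler_wpM2r ?sqr_ge0// ler_norm.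
rewrite mulrC exprS mulrA; apply: ler_wpM2r; first exact: sqr_ge0.
have := ler_norm c3; have := normr_ge0 c3; nra.
Qed.

(** * Energy of combinations of densities *)

Section energy.
Context (R : realType) (n : nat).
Local Notation mu := (rV_lebesgue R n).
Local Notation sqint := (sqint mu).
Local Notation ip := (ip mu).
Implicit Types (phi psi : 'rV[R]_n -> R[i]) (w : 'rV[R]_n -> R).

Lemma modulus_ofreal w x : 0 <= w x -> modulus (ofreal w x) = w x.
Proof. by move=> w0; rewrite /modulus /= expr0n/= addr0 sqrtr_sqr ger0_norm. Qed.

Lemma modulus_dist (z z' : R[i]) : (modulus z - modulus z') ^+ 2 <= modulus (z - z') ^+ 2.
Proof.
have tri (a b : R[i]) : modulus a - modulus b <= modulus (a - b).
  by rewrite lerBlDr -{1}(subrK b a); exact: complex.le_normcD.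
have sym : modulus (z' - z) = modulus (z - z').
  by rewrite -opprB; exact: complex.normcN.
rewrite -real_normK ?num_real// lerXn2r ?nnegrE ?modulus_ge0//.
by rewrite ler_norml tri andbT lerNl opprB -sym tri.
Qed.

Lemma measurable_modulus phi : L2 phi -> measurable_fun setT (fun x => modulus (phi x)).
Proof.
move=> Lphi.
have -> : (fun x => modulus (phi x)) = (fun x => Num.sqrt (re phi x ^+ 2 + im phi x ^+ 2)).
  apply/funext => x; rewrite -modulus_sqr sqrtr_sqr ger0_norm//; exact: modulus_ge0.
apply: (measurableT_comp (continuous_measurable_fun (@sqrt_continuous R))).
by apply: measurable_funD; apply: measurable_funX; [exact: measurable_re|exact: measurable_im].
Qed.

(** The reverse triangle inequality for the weighted Euclidean norm. *)
Lemma weighted_dist (a b x1 x2 y1 y2 : R) : 0 <= a -> 0 <= b ->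
  0 <= x1 -> 0 <= x2 -> 0 <= y1 -> 0 <= y2 ->
  (Num.sqrt (a * x1 ^+ 2 + b * x2 ^+ 2) - Num.sqrt (a * y1 ^+ 2 + b * y2 ^+ 2)) ^+ 2 <=
  a * (x1 - y1) ^+ 2 + b * (x2 - y2) ^+ 2.
Proof.
move=> a0 b0 x10 x20 y10 y20.
set X := a * x1 ^+ 2 + _; set Y := a * y1 ^+ 2 + _.
have X0 : 0 <= X by rewrite addr_ge0// mulr_ge0// sqr_ge0.
have Y0 : 0 <= Y by rewrite addr_ge0// mulr_ge0// sqr_ge0.
rewrite sqrrB !sqr_sqrtr//.
have Z0 : 0 <= a * x1 * y1 + b * x2 * y2 by rewrite addr_ge0// !mulr_ge0.
have h : a * x1 * y1 + b * x2 * y2 <= Num.sqrt X * Num.sqrt Y.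
  rewrite -sqrtrM// -(@ler_pXn2r _ 2)// ?nnegrE ?sqrtr_ge0//.
  rewrite sqr_sqrtr ?mulr_ge0// -subr_ge0.
  have -> : X * Y - (a * x1 * y1 + b * x2 * y2) ^+ 2 = a * b * (x1 * y2 - x2 * y1) ^+ 2.
    by rewrite /X /Y; ring.
  by rewrite mulr_ge0 ?sqr_ge0// mulr_ge0.
by rewrite /X /Y in h *; lra.
Qed.

Variables (V W : 'rV[R]_n -> R).
Hypotheses (V0 : forall x, 0 <= V x) (W0 : forall x, 0 <= W x)
  (mW : measurable_fun setT W) (VW : {ae mu, forall x, V x = W x}).

Lemma potential_termE phi : L2 phi ->
  potential_term V phi = (\int[mu]_x (W x * modulus (phi x) ^+ 2)%:E)%E.
Proof.
move=> Lphi; apply: ge0_integral_ae_eq_measurable.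
- by move=> x; rewrite lee_fin mulr_ge0 ?sqr_ge0.
- by move=> x; rewrite lee_fin mulr_ge0 ?sqr_ge0.
- apply/measurable_EFinP/measurable_funM => //.
  by apply: measurable_funX; exact: measurable_modulus.
- by apply: filterS VW => x ->.
Qed.

Lemma integral_lincomb (f g h : 'rV[R]_n -> R) (a b : R) : 0 <= a -> 0 <= b ->
  measurable_fun setT f -> measurable_fun setT g -> measurable_fun setT h ->
  (forall x, 0 <= f x) -> (forall x, 0 <= g x) -> (forall x, 0 <= h x) ->
  (forall x, h x <= a * f x + b * g x) ->
  (\int[mu]_x (h x)%:E <= a%:E * \int[mu]_x (f x)%:E + b%:E * \int[mu]_x (g x)%:E)%E.
Proof.
move=> a0 b0 mf mg mh f0 g0 h0 hfg.
have af0 x : 0 <= a * f x by rewrite mulr_ge0.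
have bg0 x : 0 <= b * g x by rewrite mulr_ge0.
have maf : measurable_fun setT (fun x => (a * f x)%:E).
  by apply/measurable_EFinP; exact: measurable_funM.
have mbg : measurable_fun setT (fun x => (b * g x)%:E).
  by apply/measurable_EFinP; exact: measurable_funM.
have mf' : measurable_fun setT (EFin \o f) by exact/measurable_EFinP.
have mg' : measurable_fun setT (EFin \o g) by exact/measurable_EFinP.
have f0' x : setT x -> (0 <= (f x)%:E)%E by rewrite lee_fin.
have g0' x : setT x -> (0 <= (g x)%:E)%E by rewrite lee_fin.
rewrite -!ge0_integralZl_EFin//.
rewrite -ge0_integralD//; [|by move=> x _; rewrite lee_fin..].
apply: ge0_le_integral => //.
- by move=> x _; rewrite lee_fin.
- exact/measurable_EFinP.
- exact: (emeasurable_funD maf mbg).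
- by move=> x _; rewrite -!EFinM -EFinD lee_fin.
Qed.

Lemma integral_lincombE (f g h : 'rV[R]_n -> R) (a b : R) : 0 <= a -> 0 <= b ->
  measurable_fun setT f -> measurable_fun setT g ->
  (forall x, 0 <= f x) -> (forall x, 0 <= g x) ->
  (forall x, h x = a * f x + b * g x) ->
  (\int[mu]_x (h x)%:E = a%:E * \int[mu]_x (f x)%:E + b%:E * \int[mu]_x (g x)%:E)%E.
Proof.
move=> a0 b0 mf mg f0 g0 hfg.
have maf : measurable_fun setT (fun x => (a * f x)%:E).
  by apply/measurable_EFinP; exact: measurable_funM.
have mbg : measurable_fun setT (fun x => (b * g x)%:E).
  by apply/measurable_EFinP; exact: measurable_funM.
have mf' : measurable_fun setT (EFin \o f) by exact/measurable_EFinP.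
have mg' : measurable_fun setT (EFin \o g) by exact/measurable_EFinP.
have f0' x : setT x -> (0 <= (f x)%:E)%E by rewrite lee_fin.
have g0' x : setT x -> (0 <= (g x)%:E)%E by rewrite lee_fin.
rewrite -!ge0_integralZl_EFin//.
rewrite -ge0_integralD//; [|by move=> x _; rewrite lee_fin mulr_ge0..].
by apply: eq_integral => x _; rewrite hfg.
Qed.

Section combination.
Variables (phi psi : 'rV[R]_n -> R[i]) (a b : R).
Hypotheses (a0 : 0 <= a) (b0 : 0 <= b).
Hypotheses (Xphi : energy_space V phi) (Xpsi : energy_space V psi).

Definition combination (x : 'rV[R]_n) : R :=
  Num.sqrt (a * modulus (phi x) ^+ 2 + b * modulus (psi x) ^+ 2).

(** Serves two functions w: the combination of phi and psi, with equality in the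
    first bound, and the truncation of phi, with b = 0. *)
Lemma dominated_energy_space w : measurable_fun setT w -> (forall x, 0 <= w x) ->
  (forall x, w x ^+ 2 <= a * modulus (phi x) ^+ 2 + b * modulus (psi x) ^+ 2) ->
  (forall x y, (w x - w y) ^+ 2 <=
     a * (modulus (phi x) - modulus (phi y)) ^+ 2 +
     b * (modulus (psi x) - modulus (psi y)) ^+ 2) ->
  [/\ energy_space V (ofreal w),
     (grad_sqnorm (ofreal w) <= a%:E * grad_sqnorm phi + b%:E * grad_sqnorm psi)%E &
     (potential_term V (ofreal w) <=
       a%:E * potential_term V phi + b%:E * potential_term V psi)%E].
Proof.
move=> mw w0 wle wlip.
have [[Lphi _] Pphi] := Xphi; have [[Lpsi _] Ppsi] := Xpsi.
have mphi := measurable_modulus Lphi; have mpsi := measurable_modulus Lpsi.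
have sw : sqint w.
  split=> //.
  have := @integral_lincomb (fun x => modulus (phi x) ^+ 2) (fun x => modulus (psi x) ^+ 2)
    (fun x => w x ^+ 2) a b a0 b0 (measurable_funX 2 mphi) (measurable_funX 2 mpsi)
    (measurable_funX 2 mw) (fun x => sqr_ge0 _) (fun x => sqr_ge0 _) (fun x => sqr_ge0 _) wle.
  move=> /le_lt_trans; apply.
  rewrite -[X in (_ * X + _)%E]/(mass phi) -[X in (_ + _ * X)%E]/(mass psi).
  by rewrite !massE// -!EFinM -EFinD ltry.
have [Hw Kw] := @lipschitz_H1 _ _ w phi psi a b a0 b0 Xphi.1 Xpsi.1 sw (fun x y =>
  le_trans (wlip x y) (lerD (ler_wpM2l a0 (modulus_dist _ _)) (ler_wpM2l b0 (modulus_dist _ _)))).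
have Pw : (potential_term V (ofreal w) <=
       a%:E * potential_term V phi + b%:E * potential_term V psi)%E.
  rewrite !potential_termE//; last by case: Hw.
  apply: integral_lincomb => //; try (by move=> x; rewrite mulr_ge0 ?sqr_ge0).
  - by apply: measurable_funM => //; exact: measurable_funX.
  - by apply: measurable_funM => //; exact: measurable_funX.
  - apply: measurable_funM => //; apply: measurable_funX.
    by apply: measurable_modulus; case: Hw.
  - move=> x; rewrite modulus_ofreal//.
    by rewrite (mulrCA a) (mulrCA b) -mulrDr ler_wpM2l.
split=> //; split => //; apply: (le_lt_trans Pw).
by rewrite lte_add_pinfty// lte_mul_pinfty.
Qed.

End combination.
End energy.

(** * Ground states *)

Section ground_states.
Context (R : realType) (n : nat).
Local Notation mu := (rV_lebesgue R n).
Local Notation sqint := (sqint mu).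
Local Notation ip := (ip mu).
Implicit Types (phi psi : 'rV[R]_n -> R[i]) (w : 'rV[R]_n -> R).
Variables (V W : 'rV[R]_n -> R).
Hypotheses (V0 : forall x, 0 <= V x) (W0 : forall x, 0 <= W x)
  (mW : measurable_fun setT W) (VW : {ae mu, forall x, V x = W x}).

Lemma ge0_finite (x : \bar R) : (0 <= x)%E -> (x < +oo)%E ->
  exists2 r, 0 <= r & x = r%:E.
Proof.
by move=> x0 xoo; exists (fine x); rewrite ?fine_ge0// fineK// ge0_fin_numE.
Qed.

Lemma energy_space_finite phi : energy_space V phi ->
  [/\ 0 <= grad_sqnorm phi < +oo, 0 <= potential_term V phi < +oo &
      0 <= mass phi < +oo]%E.
Proof.
move=> [Hphi Pphi]; split.
- rewrite grad_sqnormE// ltry lee_fin andbT.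
  by apply: sumr_ge0 => j _; exact: nsq_ge0.
- rewrite Pphi andbT; apply: integral_ge0 => x _.
  by rewrite lee_fin mulr_ge0 ?sqr_ge0.
- by case: Hphi => Lphi _; rewrite massE// ltry lee_fin nsq_ge0.
Qed.

Lemma Lq_term_ge0 (q : R) phi : (0 <= Lq_term q phi)%E.
Proof. by apply: integral_ge0 => x _; rewrite lee_fin powR_ge0. Qed.

Lemma energy_lty (p : R) phi : 0 < p -> energy_space V phi ->
  (Lq_term (p + 1) phi < +oo)%E <-> (energy V p phi < +oo)%E.
Proof.
move=> p0 /energy_space_finite[/andP[K0 Kf] /andP[P0 Pf] _].
have L0 := Lq_term_ge0 (p + 1) phi.
have q0 : 0 < 2 / (p + 1) by rewrite divr_gt0//; lra.
rewrite /energy -(@fineK _ (grad_sqnorm phi)) ?ge0_fin_numE//.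
rewrite -(@fineK _ (potential_term V phi)) ?ge0_fin_numE//; split=> [Lf|].
  by rewrite -(@fineK _ (Lq_term (p + 1) phi)) ?ge0_fin_numE// -!EFinM -!EFinD ltry.
rewrite !ltey; apply: contra => /eqP ->.
by rewrite gt0_muley ?lte_fin// addey.
Qed.

(** A multiple of min (|phi|, 1) has mass m and finite energy: it belongs to the
    energy space as a Lipschitz image of phi, and since its values are bounded
    its (p + 1)-th power is dominated by its square.  A ground state cannot
    have a larger energy. *)
Lemma energy_ground_state_Lq_lty (p m : R) phi : 1 < p -> 0 < m ->
  energy_ground_states V p m phi -> (Lq_term (p + 1) phi < +oo)%E.
Proof.
move=> p1 m0 [[Xphi mphi] phimin]; have p0 : 0 < p by lra.
have [[Lphi _] Pphi] := Xphi; have mm := measurable_modulus Lphi.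
pose w1 x := Num.min (modulus (phi x)) 1.
have w10 x : 0 <= w1 x by rewrite le_min modulus_ge0 ler01.
have w1le x : w1 x <= modulus (phi x) by rewrite ge_min lexx.
have w11 x : w1 x <= 1 by rewrite ge_min lexx orbT.
have mw1 : measurable_fun setT w1 by apply: measurable_minr.
pose m1 := (\int[mu]_x (w1 x ^+ 2)%:E)%E.
have m1le : (m1 <= m%:E)%E.
  rewrite -mphi; apply: ge0_le_integral => //.
  - by move=> x _; rewrite lee_fin sqr_ge0.
  - by apply/measurable_EFinP; exact: measurable_funX.
  - by apply/measurable_EFinP; exact: measurable_funX.
  - by move=> x _; rewrite lee_fin lerXn2r// ?nnegrE ?modulus_ge0.
have m1_ge0 : (0 <= m1)%E by apply: integral_ge0 => x _; rewrite lee_fin sqr_ge0.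
have m1fin : m1 \is a fin_num by rewrite ge0_fin_numE// (le_lt_trans m1le) ?ltry.
have m1n0 : m1 != 0%E.
  apply/eqP => m1z.
  have := m0; rewrite -lte_fin -mphi lt_neqAle => /andP[/eqP + _]; apply.
  have mw12 : measurable_fun setT (fun x => (w1 x ^+ 2)%:E).
    by apply/measurable_EFinP; exact: measurable_funX.
  have : (\int[mu]_x `|(w1 x ^+ 2)%:E| = 0)%E.
    by rewrite -[RHS]m1z; apply: eq_integral => x _; rewrite gee0_abs// lee_fin sqr_ge0.
  move=> /(ae_eq_integral_abs mu measurableT mw12) w1ae.
  rewrite /mass (ae_eq_integral (cst 0%E)) ?integral0//.
    by apply/measurable_EFinP; exact: measurable_funX.
  apply: filterS w1ae => x /(_ I) [] /eqP; rewrite sqrf_eq0 /w1 => /eqP h _.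
  suff -> : modulus (phi x) = 0 by rewrite expr0n.
  by move: h; rewrite /Num.min; case: ltP => // _ /eqP; rewrite oner_eq0.
pose r1 := fine m1.
have r10 : 0 < r1 by rewrite fine_gt0// lt0e m1n0 m1_ge0 -ge0_fin_numE.
(* Scaling by sqrt c restores the mass m. *)
pose c := m / r1.
have c0 : 0 < c by rewrite divr_gt0.
pose w x := Num.sqrt c * w1 x.
have w0 x : 0 <= w x by rewrite mulr_ge0 ?sqrtr_ge0.
have mw : measurable_fun setT w by exact: measurable_funM.
have w2 x : w x ^+ 2 = c * w1 x ^+ 2 by rewrite exprMn sqr_sqrtr ?ltW.
have wle x : w x ^+ 2 <= c * modulus (phi x) ^+ 2 + 0 * modulus (phi x) ^+ 2.
  rewrite mul0r addr0 w2 ler_pM2l//.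
  by rewrite lerXn2r// ?nnegrE ?modulus_ge0.
have wlip x y : (w x - w y) ^+ 2 <= c * (modulus (phi x) - modulus (phi y)) ^+ 2 +
    0 * (modulus (phi x) - modulus (phi y)) ^+ 2.
  rewrite mul0r addr0 /w -mulrBr exprMn sqr_sqrtr ?(ltW c0)// ler_pM2l//.
  rewrite /w1; move: (modulus (phi x)) (modulus (phi y)) => s t.
  rewrite /Num.min; have := sqr_ge0 (s - t).
  by case: ltP => s1; case: ltP => t1; nra.
have [Xw Kw Pw] := dominated_energy_space V0 W0 mW VW (ltW c0) (lexx 0)
  Xphi Xphi mw w0 wle wlip.
have Ew : (energy V p (ofreal w) < +oo)%E.
  apply/(energy_lty p0 Xw).
  have w1pow x : w1 x `^ (p + 1) <= w1 x ^+ 2.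
    rewrite -powR_mulrn//; have [->|w1n0] := eqVneq (w1 x) 0.
      by rewrite !powR0// gt_eqF//; lra.
    by apply: ger_powR; [rewrite lt_neqAle eq_sym w1n0 w10 w11|lra].
  have := @integral_lincomb _ _ (fun x => w1 x ^+ 2) (fun x => w1 x ^+ 2)
    (fun x => modulus (ofreal w x) `^ (p + 1)) (Num.sqrt c `^ (p + 1)) 0 (powR_ge0 _ _)
    (lexx 0) (measurable_funX 2 mw1) (measurable_funX 2 mw1)
    (measurableT_comp (measurable_powR (p + 1)) (measurable_modulus Xw.1.1))
    (fun x => sqr_ge0 _) (fun x => sqr_ge0 _) (fun x => powR_ge0 _ _).
  rewrite -/m1 mul0e adde0 => h; apply: le_lt_trans (h _) _; last first.
    by rewrite -(fineK m1fin) -EFinM ltry.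
  move=> x; rewrite modulus_ofreal// mul0r addr0 /w powRM ?sqrtr_ge0//.
  by rewrite ler_wpM2l ?powR_ge0.
have Mw : mass (ofreal w) = m%:E.
  rewrite /mass; under eq_integral do rewrite modulus_ofreal// w2 EFinM.
  rewrite ge0_integralZl_EFin//.
  - by rewrite -/m1 -(fineK m1fin) -EFinM /c -/r1 divfK// gt_eqF.
  - by move=> x _; rewrite lee_fin sqr_ge0.
  - by apply/measurable_EFinP; exact: measurable_funX.
  - exact: ltW.
apply/(energy_lty p0 Xphi).
exact: le_lt_trans (phimin _ (conj Xw Mw)) Ew.
Qed.

Lemma measurable_combination (a b : R) phi psi : L2 phi -> L2 psi ->
  measurable_fun setT (combination phi psi a b).
Proof.
move=> /measurable_modulus mphi /measurable_modulus mpsi.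
apply: (measurableT_comp (continuous_measurable_fun (@sqrt_continuous R))).
by apply: measurable_funD; apply: measurable_funM => //; exact: measurable_funX.
Qed.

Lemma combination_energy (a b : R) phi psi : 0 <= a -> 0 <= b ->
  energy_space V phi -> energy_space V psi ->
  let w := ofreal (combination phi psi a b) in
  [/\ energy_space V w,
    (grad_sqnorm w <= a%:E * grad_sqnorm phi + b%:E * grad_sqnorm psi)%E,
    (potential_term V w <= a%:E * potential_term V phi + b%:E * potential_term V psi)%E &
    mass w = (a%:E * mass phi + b%:E * mass psi)%E].
Proof.
move=> a0 b0 Xphi Xpsi w.
have [[Lphi _] _] := Xphi; have [[Lpsi _] _] := Xpsi.
have mphi := measurable_modulus Lphi; have mpsi := measurable_modulus Lpsi.
have w0 x : 0 <= combination phi psi a b x by exact: sqrtr_ge0.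
have w2 x : combination phi psi a b x ^+ 2 =
    a * modulus (phi x) ^+ 2 + b * modulus (psi x) ^+ 2.
  by rewrite sqr_sqrtr// addr_ge0// mulr_ge0// sqr_ge0.
have wle x : combination phi psi a b x ^+ 2 <=
    a * modulus (phi x) ^+ 2 + b * modulus (psi x) ^+ 2 by rewrite w2.
have mw := measurable_combination a b Lphi Lpsi.
have [Xw Kw Pw] := dominated_energy_space V0 W0 mW VW a0 b0 Xphi Xpsi mw w0 wle
  (fun x y => weighted_dist a0 b0 (modulus_ge0 _) (modulus_ge0 _)
    (modulus_ge0 _) (modulus_ge0 _)).
split => //; rewrite /mass.
apply: integral_lincombE => //; try exact: measurable_funX.
- by move=> x; exact: sqr_ge0.
- by move=> x; exact: sqr_ge0.
- by move=> x; rewrite modulus_ofreal.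
Qed.

(** Convexity of s |-> s^q, and its homogeneity for the factor l. *)
Lemma powR_combination (l t q x y : R) : 0 <= l -> 0 <= t <= 1 -> 1 <= q ->
  0 <= x -> 0 <= y ->
  Num.sqrt (l * (1 - t) * x ^+ 2 + l * t * y ^+ 2) `^ (2 * q) <=
  l `^ q * (1 - t) * x `^ (2 * q) + l `^ q * t * y `^ (2 * q).
Proof.
move=> l0 /andP[t0 t1] q1 x0 y0.
have t1' : 0 <= 1 - t by rewrite subr_ge0.
set S := (1 - t) * x ^+ 2 + t * y ^+ 2.
have S0 : 0 <= S by rewrite addr_ge0// mulr_ge0// sqr_ge0.
rewrite (_ : _ + _ = l * S); last by rewrite /S; ring.
have pow2 z : 0 <= z -> z `^ (2 * q) = (z ^+ 2) `^ q.
  by move=> z0; rewrite powRrM powR_mulrn.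
rewrite pow2 ?sqrtr_ge0// sqr_sqrtr ?mulr_ge0// powRM// !pow2//.
rewrite -!mulrA -mulrDr ler_wpM2l ?powR_ge0//.
have t11 : 1 - t <= 1 by rewrite gerBl.
have h := @convex_powR R q q1 (Itv01 t1' t11) (x ^+ 2) (y ^+ 2).
have SE : S = conv (Itv01 t1' t11) (x ^+ 2 : R^o) (y ^+ 2 : R^o).
  by rewrite convRE /= /unstable.onem subKr.
rewrite convRE /= /unstable.onem subKr in h.
by rewrite SE; apply: h; rewrite inE /= in_itv /= andbT sqr_ge0.
Qed.

Lemma combination_Lq (l t q : R) phi psi : 0 <= l -> 0 <= t <= 1 -> 1 <= q ->
  L2 phi -> L2 psi ->
  (Lq_term (2 * q) (ofreal (combination phi psi (l * (1 - t)) (l * t))) <=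
   (l `^ q * (1 - t))%:E * Lq_term (2 * q) phi + (l `^ q * t)%:E * Lq_term (2 * q) psi)%E.
Proof.
move=> l0 t01 q1 Lphi Lpsi; have /andP[t0 t1] := t01.
have mp (f : 'rV[R]_n -> R) : measurable_fun setT f ->
    measurable_fun setT (fun x => f x `^ (2 * q)).
  by move=> mf; exact: (measurableT_comp (measurable_powR (2 * q)) mf).
apply: integral_lincomb => //.
- by rewrite mulr_ge0 ?powR_ge0// subr_ge0.
- by rewrite mulr_ge0 ?powR_ge0.
- by apply: mp; exact: measurable_modulus.
- by apply: mp; exact: measurable_modulus.
- have -> : (fun x => modulus (ofreal (combination phi psi (l * (1 - t)) (l * t)) x) `^ (2 * q)) =
      (fun x => combination phi psi (l * (1 - t)) (l * t) x `^ (2 * q)).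
    by apply/funext => x; rewrite modulus_ofreal// sqrtr_ge0.
  by apply: mp; exact: measurable_combination.
- by move=> x; exact: powR_ge0.
- by move=> x; exact: powR_ge0.
- by move=> x; exact: powR_ge0.
- move=> x; rewrite modulus_ofreal ?sqrtr_ge0//.
  by apply: powR_combination; rewrite ?modulus_ge0.
Qed.

Lemma energy_ground_state_action_le (p m : R) phi psi : 1 < p -> 0 < m ->
  energy_ground_states V p m phi -> energy_space V psi ->
  (action V p (- chemical_potential V p phi) phi <=
   action V p (- chemical_potential V p phi) psi)%E.
Proof.
move=> p1 m0 gphi Xpsi; have p0 : 0 < p by lra.
have Nphi := energy_ground_state_Lq_lty p1 m0 gphi.
have [[Xphi mphi] phimin] := gphi.
have [/andP[K0 Kf] /andP[P0 Pf] _] := energy_space_finite Xphi.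
have [/andP[K0' Kf'] /andP[P0' Pf'] /andP[M0' Mf']] := energy_space_finite Xpsi.
have L0 := Lq_term_ge0 (p + 1) phi; have L0' := Lq_term_ge0 (p + 1) psi.
have [[Lphi _] _] := Xphi; have [[Lpsi _] _] := Xpsi.
rewrite /action; set omega := - _.
have [Npsi|] := boolP (Lq_term (p + 1) psi < +oo)%E; last first.
  rewrite ltey negbK => /eqP Npsi.
  have -> : energy V p psi = +oo%E.
    apply/eqP; rewrite -[_ == _]negbK -ltey; apply/negP => /energy_lty.
    by rewrite Npsi ltxx => /(_ p0 Xpsi).
  by rewrite addye ?leey// -(@fineK _ (mass psi)) ?ge0_fin_numE// -EFinM.
have [k0 k00 Ek0] := ge0_finite K0 Kf.
have [k1 k10 Ek1] := ge0_finite K0' Kf'.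
have [v0 v00 Ev0] := ge0_finite P0 Pf.
have [v1 v10 Ev1] := ge0_finite P0' Pf'.
have [N0 N00 EN0] := ge0_finite L0 Nphi.
have [N1 N10 EN1] := ge0_finite L0' Npsi.
have [M M0 EM] := ge0_finite M0' Mf'.
pose q := (p + 1) / 2.
have q1 : 1 <= q by rewrite /q; lra.
have q0 : 0 < q by lra.
have pq : p + 1 = 2 * q by rewrite /q; field.
have iq : 2 / (p + 1) = q^-1 by rewrite /q invf_div.
pose A0 := 2^-1 * k0 + v0; pose A1 := 2^-1 * k1 + v1.
have Eom : omega = - ((A0 + N0) / m).
  rewrite /omega /chemical_potential mphi Ek0 Ev0 EN0 -EFinM -!EFinD /=.
  by [].
have E0 : energy V p phi = (A0 + N0 / q)%:E.
  by rewrite /energy Ek0 Ev0 EN0 iq -!EFinM -!EFinD (mulrC q^-1).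
have E1 : energy V p psi = (A1 + N1 / q)%:E.
  by rewrite /energy Ek1 Ev1 EN1 iq -!EFinM -!EFinD (mulrC q^-1).
rewrite E0 E1 mphi EM -!EFinM -!EFinD lee_fin Eom.
suff : (A0 + N0) / m * (M - m) <= (A1 + N1 / q) - (A0 + N0 / q) by lra.
apply: first_variation => //; try by rewrite addr_ge0// mulr_ge0.
move=> t /andP[t0 t1] /=; set l := m / _.
have t1' : 0 < 1 - t by rewrite subr_gt0.
have D0 : 0 < (1 - t) * m + t * M by rewrite ltr_pwDl ?mulr_gt0// mulr_ge0// ltW.
have l0 : 0 < l by rewrite divr_gt0.
have a0 : 0 <= l * (1 - t) by rewrite mulr_ge0 ?ltW.
have b0 : 0 <= l * t by rewrite mulr_ge0 ?ltW.
have [Xw Kw Pw Mw] := combination_energy a0 b0 Xphi Xpsi.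
have t01 : 0 <= t <= 1 by rewrite !ltW.
have Nw := combination_Lq (ltW l0) t01 q1 Lphi Lpsi.
rewrite -pq in Nw.
have Mwm : mass (ofreal (combination phi psi (l * (1 - t)) (l * t))) = m%:E.
  rewrite Mw mphi EM -!EFinM -EFinD; congr (_%:E).
  have lD : l * ((1 - t) * m + t * M) = m by rewrite /l divfK// gt_eqF.
  by rewrite -[RHS]lD; ring.
have Ew := phimin _ (conj Xw Mwm).
rewrite Ek0 Ek1 -!EFinM -EFinD in Kw; rewrite Ev0 Ev1 -!EFinM -EFinD in Pw.
rewrite EN0 EN1 -!EFinM -EFinD in Nw.
have {}Ew : ((A0 + N0 / q)%:E <=
   (2^-1 * (l * (1 - t) * k0 + l * t * k1) + (l * (1 - t) * v0 + l * t * v1) +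
     q^-1 * (l `^ q * (1 - t) * N0 + l `^ q * t * N1))%:E)%E.
  rewrite -E0; apply: (le_trans Ew); rewrite /energy iq !EFinD.
  apply: leeD; first apply: leeD => //.
    by rewrite EFinM lee_wpmul2l// lee_fin invr_ge0.
  by rewrite [leRHS]EFinM lee_wpmul2l// lee_fin invr_ge0 ltW.
rewrite lee_fin in Ew; apply: (le_trans Ew); rewrite le_eqVlt; apply/orP; left; apply/eqP.
rewrite /A0 /A1; by move: (l `^ q) => lq; field; rewrite gt_eqF.
Qed.

End ground_states.

Unset Implicit Arguments.
Set Strict Implicit.
Set Printing Implicit Defensive.

(* hVlim: V x tends to +oo as |x| does (the sup norm of 'rV[R]_d is equivalent
   to the Euclidean one). *)
Theorem theorem3p2 (R : realType) (d : nat) (hd : (1 <= d)%N)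
  (p : R) (hp1 : 1 < p)
  (hp2 : (3 <= d)%N -> p < (d%:R + 2) / (d%:R - 2))
  (V : 'rV[R]_d -> R) (hVmeas : lebesgue_measurable V)
  (hV0 : forall x, 0 <= V x)
  (hVlim : forall A : R, \forall r \near +oo, forall x : 'rV[R]_d,
     r <= `|x| -> A <= V x)
  (m : R) (hm : 0 < m) (phi : 'rV[R]_d -> R[i])
  (hphi : energy_ground_states V p m phi) :
  action_ground_states V p (- chemical_potential V p phi) phi.
Proof.
have [W' mW' VW'] := hVmeas.
pose W x := Num.max (W' x) 0.
have mW : measurable_fun setT W by exact: measurable_maxr.
have W0 x : 0 <= W x by rewrite le_max lexx orbT.
have VW : {ae rV_lebesgue R d, forall x, V x = W x}.
  by apply: filterS VW' => x VWx; rewrite /W -VWx; apply/esym/max_idPl.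
split=> [|psi Xpsi]; first by case: hphi => -[].
exact: (energy_ground_state_action_le hV0 W0 mW VW hp1 hm hphi Xpsi).
Qed.
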